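(* Let $b\in\mathbb{R}^N$. Assume that the Gaussian inner product converges on the minimal $H_c(W)$-module $\mathbb{S}_c\subset\mathbb{C}[x_1,\dots,x_N]$. Then the Gaussian inner product converges on the $H_c(W_b)$-module $\mathrm{Res}_b(\mathbb{S}_c)$.
   Context: Let $\mathcal{R}\subset\mathbb{R}^N$ be an irreducible Coxeter root system of rank $N$ with positive roots $\mathcal{R}_+$ and Coxeter group $W$ generated by the reflections $s_\alpha$, and let $c\in\mathbb{R}$ be constant. The Dunkl operators on $\mathbb{C}[x]=\mathbb{C}[x_1,\dots,x_N]$ are $\nabla_\xi=\partial_\xi-\sum_{\alpha\in\mathcal{R}_+}\frac{c(\alpha,\xi)}{(\alpha,x)}(1-s_\alpha)$. The rational Cherednik algebra $H_c(W)$ is defined by its faithful (polynomial) representation on $\mathbb{C}[x]$, generated by $W$, multiplications by $x_i$, and the $\nabla_{e_i}$. The minimal submodule $\mathbb{S}_c$ is the unique minimal non-zero $H_c(W)$-submodule of $\mathbb{C}[x]$; it is an ideal. The Gaussian inner product converges on $\mathbb{S}_c$ if $\int_{\mathbb{R}^N}|f(x)|^2e^{-\frac12|x|^2}\prod_{\alpha\in\mathcal{R}_+}|(\alpha,x)|^{-2c}dx<\infty$ for all $f\in\mathbb{S}_c$. For $b\in\mathbb{R}^N$ let $L_b$ be the minimal stratum containing $b$ (the intersection of all reflection hyperplanes containing $b$, or $\mathbb{R}^N$ if there are none), $n$ its codimension, and $W_b\subset W$ the parabolic subgroup stabilizing $L_b$ (pointwise); its positive roots are the $\alpha\in\mathcal{R}_+$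 with $(\alpha,L_b)=0$. Let $M$ be the $n$-dimensional affine plane through $b$ orthogonal to $L_b$; $W_b$ acts on $M$ fixing $b$, which is taken as origin, and $H_c(W_b)$ acts on the polynomials on $M$ via the corresponding Dunkl operators. $\mathrm{Res}_b$ is the Bezrukavnikov–Etingof restriction functor. The module $\mathrm{Res}_b(\mathbb{S}_c)$ is obtained by completing the ideal $\mathbb{S}_c$ at $b$, giving $\widehat{(\mathbb{S}_c)}_b\subset\mathbb{C}[[x-b]]$, and then extracting the polynomials in it which are constant in the direction of $L_b$, viewed as polynomials on $M$. Convergence of the Gaussian inner product on $\mathrm{Res}_b(\mathbb{S}_c)$ means $$\int_M|f(x)|^2e^{-\frac12|x-b|^2}\prod_{\alpha\in\mathcal{R}_+,\ (\alpha,L_b)=0}|(\alpha,x)|^{-2c}\,dx<\infty\quad\text{for all } f\in\mathrm{Res}_b(\mathbb{S}_c).$$ *)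

(* Defs.v *)
From HB Require Import structures.
From mathcomp Require Import all_boot all_order all_algebra finmap.
From mathcomp Require Import complex.
(* The notations of mpoly clash with those of mathcomp-analysis. *)
From mathcomp Require Import -(notations) mpoly.
From mathcomp Require Import all_classical all_reals all_analysis.
From mathcomp Require Import ring.

Set Implicit Arguments.
Unset Strict Implicit.
Unset Printing Implicit Defensive.

Import Order.TTheory GRing.Theory Num.Theory.
Import numFieldNormedType.Exports.

Local Open Scope classical_set_scope.
Local Open Scope ring_scope.

Section LebesgueCons.
Context {R : realType} {n : nat}.
Local Open Scope ereal_scope.
Local Notation T := (measurableTypeR R).

Definition cons_pair (p : T * n.-tuple T) : n.+1.-tuple T :=
  [tuple of p.1 :: p.2].

Lemma measurable_cons_pair : measurable_fun setT cons_pair.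
Proof. exact: (measurable_cons measurable_fst measurable_snd). Qed.

HB.instance Definition _ := isMeasurableFun.Build _ _ _ _ _ measurable_cons_pair.

Definition uncons_pair (t : n.+1.-tuple T) : T * n.-tuple T :=
  (thead t, [tuple of behead t]).

Lemma measurable_uncons_pair : measurable_fun setT uncons_pair.
Proof.
by apply: measurable_fun_pair; [exact: measurable_tnth|exact: measurable_behead].
Qed.

Lemma uncons_pairK : cancel uncons_pair cons_pair.
Proof. by move=> t; rewrite [in RHS](tuple_eta t); apply: val_inj. Qed.

Lemma cons_pairK : cancel cons_pair uncons_pair.
Proof. by move=> [x t]; congr (_, _); apply: val_inj. Qed.

Variable mu : {sigma_finite_measure set (n.-tuple T) -> \bar R}.

Definition lebesgue_cons : set (n.+1.-tuple T) -> \bar R :=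
  pushforward (lebesgue_measure \x mu) cons_pair.

Let lebesgue_cons0 : lebesgue_cons set0 = 0.
Proof. exact: measure0. Qed.

Let lebesgue_cons_ge0 A : 0 <= lebesgue_cons A.
Proof. exact: measure_ge0. Qed.

Let lebesgue_cons_sigma_additive : semi_sigma_additive lebesgue_cons.
Proof. exact: measure_semi_sigma_additive. Qed.

HB.instance Definition _ := isMeasure.Build _ _ _ lebesgue_cons
  lebesgue_cons0 lebesgue_cons_ge0 lebesgue_cons_sigma_additive.

Let lebesgue_cons_sigma_finite : sigma_finite setT lebesgue_cons.
Proof.
have /sigma_finiteP[F [TF ndF Foo]] :=
  sigma_finiteT (lebesgue_measure : {sigma_finite_measure set T -> \bar R}).
have /sigma_finiteP[G [TG ndG Goo]] := sigma_finiteT mu.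
exists (fun i => uncons_pair @^-1` (F i `*` G i)).
  rewrite -preimage_bigcup (_ : \bigcup_i _ = setT) ?preimage_setT//.
  rewrite predeqE => -[x y]; split=> // _.
  have [i _ Fx] : (\bigcup_i F i) x by rewrite -TF.
  have [j _ Gy] : (\bigcup_i G i) y by rewrite -TG.
  exists (maxn i j) => //; split => /=.
    by move: x Fx; exact/subsetPset/ndF/leq_maxl.
  by move: y Gy; exact/subsetPset/ndG/leq_maxr.
move=> i; have [mF Fi] := Foo i; have [mG Gi] := Goo i.
have mFG : measurable (F i `*` G i) by exact: measurableX.
split; first by rewrite -[X in measurable X]setTI; exact: measurable_uncons_pair.
rewrite /lebesgue_cons /pushforward -comp_preimage.
rewrite (_ : _ \o _ = id); last by apply/funext => p /=; rewrite cons_pairK.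
by rewrite preimage_id product_measure1E// lte_mul_pinfty// ge0_fin_numE.
Qed.

HB.instance Definition _ := Measure_isSigmaFinite.Build _ _ _ lebesgue_cons
  lebesgue_cons_sigma_finite.

End LebesgueCons.

Fixpoint lebesgue_tuple (R : realType) (n : nat) :
    {sigma_finite_measure set (n.-tuple (measurableTypeR R)) -> \bar R} :=
  match n with
  | 0 => dirac ([tuple] : 0.-tuple (measurableTypeR R))
  | m.+1 => lebesgue_cons (lebesgue_tuple R m)
  end.

Lemma lebesgue_tuple_box (R : realType) (n : nat)
    (A : 'I_n -> set (measurableTypeR R)) :
  (forall i, measurable (A i)) ->
  lebesgue_tuple R n [set t | forall i, A i (tnth t i)]
  = (\prod_(i < n) lebesgue_measure (A i))%E.
Proof.
elim: n A => [|n IH] A mA.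
  by rewrite big_ord0 /= diracE mem_set // => -[].
rewrite big_ord_recl -IH //=.
rewrite /lebesgue_cons /pushforward.
rewrite -product_measure1E //.
  congr ((_ \x _)%E _); apply/seteqP; split => -[x t] /=.
    move=> h; split => [|i]; first by have := h ord0; rewrite tnth0.
    by have := h (lift ord0 i); rewrite tnthS.
  by move=> [h0 h1] i; case: (unliftP ord0 i) => [j|] ->; rewrite ?tnthS ?tnth0.
rewrite (_ : [set _ | _] =
    \bigcap_(i in [set: 'I_n]) ((@tnth n _)^~ i @^-1` A (lift ord0 i))).
  apply: fin_bigcap_measurable => // i _.
  by rewrite -[X in measurable X]setTI; apply: measurable_tnth.
by apply/seteqP; split=> t /= h i => [_|]; apply: h.
Qed.

Section RootSystems.
Context {R : realType} {N : nat}.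
Implicit Types (u v x alpha beta : 'rV[R]_N) (Phi Pos : {fset 'rV[R]_N}).

Definition dot u v : R := \sum_(i < N) u 0 i * v 0 i.

(* Acts on row vectors from the right: x *m reflection alpha =
   x - (2 (alpha, x) / (alpha, alpha)) alpha. *)
Definition reflection alpha : 'M[R]_N :=
  1%:M - (2 / dot alpha alpha) *: (alpha^T *m alpha).

Definition root_system Phi : Prop :=
  [/\ 0 \notin Phi,
      (forall alpha beta, alpha \in Phi -> beta \in Phi ->
         beta *m reflection alpha \in Phi) &
      (forall alpha (k : R), alpha \in Phi -> k *: alpha \in Phi ->
         k = 1 \/ k = -1)].

Definition full_rank Phi : Prop := <<enum_fset Phi>>%VS = fullv.

Definition irreducible_roots Phi : Prop :=
  Phi != fset0 /\
  forall A B : {fset 'rV[R]_N}, (A `|` B)%fset = Phi ->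
    (forall u v, u \in A -> v \in B -> dot u v = 0) ->
    A = fset0 \/ B = fset0.

Definition positive_system Phi Pos : Prop :=
  exists t : 'rV[R]_N,
    (forall alpha, alpha \in Phi -> dot alpha t != 0) /\
    (forall alpha, (alpha \in Pos) = (alpha \in Phi) && (0 < dot alpha t)).

Inductive coxeter_group Phi : 'M[R]_N -> Prop :=
| coxeter_one : coxeter_group Phi 1%:M
| coxeter_mul alpha w : alpha \in Phi -> coxeter_group Phi w ->
    coxeter_group Phi (reflection alpha *m w).

(* The minimal stratum L_b and the affine plane M through b orthogonal to
   it.  L_b is a linear subspace, being an intersection of hyperplanes
   through the origin. *)
Definition stratum Phi b : set 'rV[R]_N :=
  [set x | forall alpha, alpha \in Phi -> dot alpha b = 0 -> dot alpha x = 0].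

Definition normal_plane Phi b : set 'rV[R]_N :=
  [set x | forall l, stratum Phi b l -> dot (x - b) l = 0].

(* y |-> b + y B is an isometry from R^n onto M. *)
Definition orthonormal_chart Phi b (n : nat) (B : 'M[R]_(n, N)) : Prop :=
  B *m B^T = 1%:M /\
  normal_plane Phi b = range (fun y : 'rV[R]_n => b + y *m B).

Lemma dotE u v : dot u v = (u *m v^T) 0 0.
Proof. by rewrite mxE; apply: eq_bigr => i _; rewrite mxE. Qed.

Lemma dot_gt0 u : u != 0 -> 0 < dot u u.
Proof.
move=> u0; rewrite lt_neqAle eq_sym; apply/andP; split; last first.
  by apply: sumr_ge0 => i _; rewrite -expr2 sqr_ge0.
apply: contra u0; rewrite psumr_eq0; last by move=> i _; rewrite -expr2 sqr_ge0.
move=> /allP h; apply/eqP/rowP => i; rewrite mxE; apply/eqP.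
by have := h i (mem_index_enum _); rewrite /= mulf_eq0 orbb.
Qed.

Lemma orthonormal_chart_exists Phi b :
  exists n, exists B : 'M[R]_(n, N), orthonormal_chart Phi b B.
Proof.
pose D : set 'rV[R]_N := [set v | forall l, stratum Phi b l -> dot v l = 0].
have DD k (y : 'rV[R]_k) (B : 'M[R]_(k, N)) : (forall i, D (row i B)) -> D (y *m B).
  move=> hB l Ll; rewrite dotE -mulmxA mxE big1 // => i _.
  by have := hB i _ Ll; rewrite dotE -row_mul !mxE => ->; rewrite mulr0.
pose Q n := `[< exists B : 'M[R]_(n, N), B *m B^T = 1%:M /\ forall i, D (row i B) >].
have Q0 : exists n, Q n.
  exists 0; apply/asboolP; exists 0; split; last by case.
  by apply/matrixP => -[].
have QN n : Q n -> (n <= N)%N.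
  move=> /asboolP[B [BB _]]; rewrite -(mxrank1 R n) -BB.
  exact: leq_trans (mxrankM_maxl _ _) (rank_leq_col _).
case: (ex_maxnP Q0 QN) => n /asboolP[B [BB hB]] nmax.
exists n; exists B; split=> //; apply/seteqP; split; last first.
  by move=> _ [y _ <-] l Ll; rewrite addrC addKr; exact: (DD _ y B).
move=> x xD; exists ((x - b) *m B^T) => //.
set v := x - b; pose w := v - v *m B^T *m B.
have wB : w *m B^T = 0 by rewrite mulmxBl -!mulmxA BB mulmx1 subrr.
have Dw : D w.
  move=> l Ll; rewrite dotE mulmxBl mxE -dotE xD // mxE -dotE.
  by rewrite DD // subr0.
have [w0|w0] := eqVneq w 0.
  by have /eqP := w0; rewrite subr_eq0 => /eqP <-; rewrite addrC subrK.
suff /nmax : Q n.+1 by rewrite ltnn.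
apply/asboolP; rewrite -addn1.
have dw := dot_gt0 w0.
exists (col_mx B ((Num.sqrt (dot w w))^-1 *: w)); split.
  rewrite tr_col_mx mul_col_row BB !linearZ /= -!scalemxAl wB scaler0.
  rewrite (_ : B *m w^T = 0) ?scaler0; last by apply: trmx_inj; rewrite trmx_mul trmxK wB trmx0.
  have -> : (Num.sqrt (dot w w))^-1 *: ((Num.sqrt (dot w w))^-1 *: (w *m w^T))
      = 1%:M.
    rewrite [w *m _]mx11_scalar -dotE -{3}(sqr_sqrtr (ltW dw)) !scale_scalar_mx.
    have s0 : Num.sqrt (dot w w) != 0 by rewrite gt_eqF // sqrtr_gt0.
    by rewrite expr2 [X in _ * X]mulKf ?mulVf.
  by rewrite -scalar_mx_block.
move=> i; case: (split_ordP i) => j ->; first by rewrite rowKu.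
rewrite rowKd row_id => l Ll.
by rewrite dotE -scalemxAl mxE -dotE (Dw l Ll) mulr0.
Qed.
Lemma reflectionK alpha : alpha != 0 -> reflection alpha *m reflection alpha = 1%:M.
Proof.
move=> a0; have a1 : dot alpha alpha != 0 by rewrite gt_eqF ?dot_gt0.
rewrite /reflection mulmxBl mul1mx mulmxBr mulmx1 -scalemxAl -scalemxAr scalerA.
rewrite -mulmxA [_ *m (_ *m alpha)]mulmxA [alpha *m _]mx11_scalar -dotE mul_scalar_mx -scalemxAr scalerA.
rewrite (_ : _ * _ * _ = 2 * (2 / dot alpha alpha)); last by field.
rewrite -scalerBl -addrA -opprD -scalerDl.
have -> : 2 / dot alpha alpha + (2 / dot alpha alpha - 2 * (2 / dot alpha alpha)) = 0 by ring.
by rewrite scale0r subr0.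
Qed.

End RootSystems.

Section Cherednik.
Context {R : realType} {N : nat}.
Local Open Scope complex_scope.
Local Notation P := (mpoly N R[i]).
Implicit Types (p q : P) (alpha xi b x : 'rV[R]_N) (Phi Pos : {fset 'rV[R]_N}).

Definition eval p x : R[i] := meval (fun i => (x 0 i)%:C) p.

Definition coordinate (i : 'I_N) : P := mpolyX R[i] (mnm1 i).

Definition linear_form alpha : P :=
  \sum_(i < N) (alpha 0 i)%:C *: coordinate i.

(* (w p)(x) = p (w^-1 x), in the convention where w maps x to x *m w. *)
Definition poly_act (w : 'M[R]_N) p : P :=
  comp_mpoly
    [tuple \sum_(j < N) (invmx w j i)%:C *: coordinate j | i < N] p.

Definition dderiv xi p : P := \sum_(i < N) (xi 0 i)%:C *: mderiv i p.

(* The quotient p / d in C[x]; 0 if d does not divide p. *)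
Definition poly_quot p d : P := xget 0 [set q | q * d = p].

Lemma poly_quotK alpha p : alpha != 0 ->
  poly_quot (p - poly_act (reflection alpha) p) (linear_form alpha) *
    linear_form alpha = p - poly_act (reflection alpha) p.
Proof.
move=> a0; suff h : exists q, q * linear_form alpha = p - poly_act (reflection alpha) p.
  case: h => q hq.
  exact: (@xgetI _ 0 [set q | q * linear_form alpha =
                              p - poly_act (reflection alpha) p] q).
set s := poly_act _.
have sD : {morph s : x y / x + y} by move=> x y; exact: comp_mpolyD.
have sZ (a : R[i]) (f : P) : s (a *: f) = a *: s f by exact: comp_mpolyZ.
have sM : {morph s : x y / x * y} by move=> x y; exact: rmorphM.
have s1 : s 1 = 1 by exact: rmorph1.
pose E q := exists r, r * linear_form alpha = q - s q.
have EM (x y : P) : E x -> E y -> E (x * y).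
  move=> [r hr] [t ht]; exists (r * y + s x * t).
  by rewrite mulrDl mulrAC hr -mulrA ht sM mulrBl mulrBr addrA subrK.
have E1 : E 1 by exists 0; rewrite s1 mul0r subrr.
have EX i : E (coordinate i).
  exists (2 / dot alpha alpha * alpha 0 i)%:C%:A.
  rewrite /s /poly_act comp_mpolyXU -tnth_nth tnth_mktuple.
  have -> : invmx (reflection alpha) = reflection alpha.
    have U : reflection alpha \in unitmx.
      by case: (mulmx1_unit (reflectionK a0)).
    by rewrite -[RHS](mulKmx U) reflectionK // mulmx1.
  rewrite {1}(_ : coordinate i = \sum_(j < N) (i == j)%:R *: coordinate j).
    rewrite -sumrB mulr_algl scaler_sumr; apply: eq_bigr => j _.
    rewrite scalerA -scalerBl -rmorphM !mxE big_ord1 !mxE; congr (_ *: _).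
    rewrite -(rmorph_nat (real_complex R)) -rmorphB; congr (_ %:C).
    by rewrite eq_sym; ring.
  rewrite (bigD1 i) //= eqxx scale1r big1 ?addr0 // => j /negPf.
  by rewrite eq_sym => ->; rewrite scale0r.
elim/mpolyind: p => [|c m p _ _ [q hq]].
  by exists 0; rewrite mul0r /s /poly_act comp_mpoly0 subrr.
have [r hr] : E (mpolyX _ m).
  rewrite (mpolyXE_id _ m).
  apply: (big_ind E E1 EM) => i _.
  elim: (m i) => [|k IH]; first by rewrite expr0; exact: E1.
  by rewrite exprS; apply: EM; [exact: EX|exact: IH].
exists (c *: r + q); rewrite mulrDl -scalerAl hr hq sD sZ scalerBr.
by rewrite opprD addrACA.
Qed.
Definition dunkl Pos (c : R) xi p : P :=
  dderiv xi p -
  \sum_(alpha <- Pos) (c * dot alpha xi)%:C *: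
    poly_quot (p - poly_act (reflection alpha) p) (linear_form alpha).

(* H_c(W), as a subalgebra of the endomorphisms of C[x]. *)
Inductive cherednik Phi Pos (c : R) : (P -> P) -> Prop :=
| cherednik_group w : coxeter_group Phi w ->
    cherednik Phi Pos c (poly_act w)
| cherednik_mulX i : cherednik Phi Pos c (fun p => coordinate i * p)
| cherednik_dunkl i : cherednik Phi Pos c (dunkl Pos c (delta_mx 0 i))
| cherednik_scale (a : R[i]) h : cherednik Phi Pos c h ->
    cherednik Phi Pos c (fun p => a *: h p)
| cherednik_add h h' : cherednik Phi Pos c h -> cherednik Phi Pos c h' ->
    cherednik Phi Pos c (fun p => h p + h' p)
| cherednik_comp h h' : cherednik Phi Pos c h -> cherednik Phi Pos c h' ->
    cherednik Phi Pos c (h \o h').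

Definition submodule Phi Pos c (S : set P) : Prop :=
  [/\ S 0, (forall p q, S p -> S q -> S (p + q)) &
      (forall h p, cherednik Phi Pos c h -> S p -> S (h p))].

Definition minimal_submodule Phi Pos c (S : set P) : Prop :=
  [/\ submodule Phi Pos c S, S != [set 0] &
      forall T : set P, submodule Phi Pos c T -> T != [set 0] ->
        T `<=` S -> T = S].

Definition power_series := multinom N -> R[i].

(* Expansion of p in powers of x - b. *)
Definition taylor b p : power_series :=
  fun m => mcoeff m
    (comp_mpoly [tuple coordinate i + mpolyC N (b 0 i)%:C | i < N] p).

(* The completion of S at b, i.e. its closure in C[[x - b]] for the topology
   given by the powers of the maximal ideal. *)
Definition completion b (S : set P) : set power_series :=
  [set F | forall k : nat, exists2 g, S g &
     forall m : multinom N, (mdeg m < k)%N -> F m = taylor b g m].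

(* The elements of the completion that are polynomials and are constant along
   L_b; they are kept as polynomials on R^N, the corresponding polynomials on
   M being their restrictions. *)
Definition Res Phi b (S : set P) : set P :=
  [set p | completion b S (taylor b p) /\
     forall l x, stratum Phi b l -> eval p (x + l) = eval p x].

(* powR gives 0 `^ a = 0 for a != 0; this only affects the value of the weight
   on the reflection hyperplanes, which are null sets. *)
Definition gaussian_density Pos (c : R) (Q : pred 'rV[R]_N) b p x : R :=
  Normc.normc (eval p x) ^+ 2 * expR (- (1 / 2) * dot (x - b) (x - b)) *
  \prod_(alpha <- Pos | Q alpha) `|dot alpha x| `^ (- (2 * c)).

Definition row_of_tuple n (t : n.-tuple (measurableTypeR R)) : 'rV[R]_n :=
  \row_(i < n) tnth t i.

Definition gaussian_converges Pos c (S : set P) : Prop :=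
  forall f, S f ->
    (\int[lebesgue_tuple R N]_t
       (gaussian_density Pos c predT 0 f (row_of_tuple t))%:E < +oo)%E.

Definition parabolic_root Phi b : pred 'rV[R]_N :=
  fun alpha => `[< forall l, stratum Phi b l -> dot alpha l = 0 >].

Definition gaussian_converges_at Phi Pos c b (S : set P) : Prop :=
  forall (n : nat) (B : 'M[R]_(n, N)), orthonormal_chart Phi b B ->
  forall f, S f ->
    (\int[lebesgue_tuple R n]_t
       (gaussian_density Pos c (parabolic_root Phi b) b f
          (b + row_of_tuple t *m B))%:E < +oo)%E.

End Cherednik.

(* Main.v *)
(* Everything rests on homogeneity; the module structure of [S] plays no role.
   Write [P] for [p] expanded at [b] and choose [f] in [S] whose expansion [F] at [b]
   agrees with [P] beyond the degree of [P].  Near [b] the Gaussian and the roots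
   not vanishing at [b] are bounded below, so [|F|^2 w] is integrable on a small
   box, where the weight [w] of the parabolic roots is homogeneous.  Integrability
   is stable under the dilations by [t <= 1], and the homogeneous components of
   [F], being combinations of dilates [F (t_j x)], inherit it.  The low-degree ones
   are those of [P], hence the integral of [|P (r x)|^2 w] over the box grows at most
   polynomially in [r].  As [P] and [w] are constant along [L_b], Tonelli's theorem
   carries this bound to a box in [M]; rescaling gives polynomial growth of the
   integral of [|P|^2 w] over the boxes of [M] of size [2^j], which the Gaussian
   beats. *)
Require Import Defs.
From mathcomp Require Import all_boot all_order all_algebra finmap.
From mathcomp Require Import complex.
From mathcomp Require Import -(notations) mpoly.
From mathcomp Require Import all_classical all_reals all_analysis.
From mathcomp Require Import ring lra measurable_realfun.

Set Implicit Arguments.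
Unset Strict Implicit.
Unset Printing Implicit Defensive.

Import Order.TTheory GRing.Theory Num.Theory.
Import numFieldNormedType.Exports.

Local Open Scope classical_set_scope.
Local Open Scope ring_scope.

(** * Integration over [R^n] in row coordinates *)

Section AffineOneDim.
Context {R : realType}.
Local Open Scope ereal_scope.
Local Notation mu := (@lebesgue_measure R).

(** Lebesgue measure equals [a] times its pushforward under [x |-> a * x + v]: both agree on
    half-open intervals, which determine it. *)
Lemma integral_affine (a v : R) (f : measurableTypeR R -> \bar R) :
  (0 < a)%R -> measurable_fun setT f -> (forall x, 0 <= f x) ->
  \int[mu]_x f (a * x + v)%R = (a^-1)%:E * \int[mu]_x f x.
Proof.
move=> a0 mf f0; pose phi (x : measurableTypeR R) : measurableTypeR R := (a * x + v)%R.
have mphi : measurable_fun setT phi.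
  by apply: measurable_funD => //; apply: measurable_funM.
pose nu0 := (pushforward mu phi : measure (measurableTypeR R) R).
pose nu : measure (measurableTypeR R) R := mscale (NngNum (ltW a0)) (nu0 mphi).
have nuE A : measurable A -> mu A = nu A.
  apply: lebesgue_measure_unique => _ [[x y] _ <-].
  rewrite /= /nu /mscale /= /pushforward.
  have -> : phi @^-1` `]x, y] = `]((x - v) / a)%R, ((y - v) / a)%R]%classic.
    by apply/seteqP; split => z /=; rewrite !in_itv /= ltr_pdivrMr // ler_pdivlMr //
      ltrBlDr lerBrDr mulrC.
  rewrite !lebesgue_measure_itv /= !lte_fin ltr_pM2r ?invr_gt0 // ltrD2r.
  case: ifP => _; last by rewrite mule0.
  rewrite -!EFinB -EFinM; congr EFin.
  by field; rewrite gt_eqF.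
have -> : \int[mu]_x f x = \int[nu]_x f x.
  by apply: eq_measure_integral => A mA _; exact: nuE.
rewrite ge0_integral_mscale //= ge0_integral_pushforward // muleA -EFinM.
by rewrite mulVf ?gt_eqF // mul1e preimage_setT.
Qed.

End AffineOneDim.

Section LebesgueTuple.
Context {R : realType}.
Local Open Scope ereal_scope.
Local Notation T := (measurableTypeR R).
Local Notation mu := (lebesgue_tuple R).

Lemma integral_lebesgue_tupleS n (f : n.+1.-tuple T -> \bar R) :
  measurable_fun setT f -> (forall t, 0 <= f t) ->
  \int[mu n.+1]_t f t = \int[lebesgue_measure]_x \int[mu n]_t f (cons_pair (x, t)).
Proof.
move=> mf f0.
transitivity (\int[lebesgue_measure \x mu n]_p f (cons_pair p)).
  by rewrite [LHS](ge0_integral_pushforward measurable_cons_pair).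
rewrite fubini_tonelli1 //.
exact: measurableT_comp mf measurable_cons_pair.
Qed.

Definition affine_tuple n (a : R) (v : 'I_n -> R) (t : n.-tuple T) : n.-tuple T :=
  [tuple (a * tnth t i + v i)%R | i < n].

Lemma measurable_affine_tuple n a (v : 'I_n -> R) :
  measurable_fun setT (affine_tuple a v).
Proof.
apply/measurable_fun_tnthP => i; rewrite /comp/=.
rewrite (_ : (fun x => _) = (fun t : n.-tuple T => (a * tnth t i + v i)%R)).
  apply: measurable_funD => //; apply: measurable_funM => //.
  exact: measurable_tnth.
by apply/funext => t; rewrite tnth_mktuple.
Qed.

(** Induction by Tonelli: the one-dimensional substitution treats the first coordinate, the
    induction hypothesis the others, and each coordinate contributes a factor [a^-1]. *)
Lemma integral_affine_tuple n (a : R) (v : 'I_n -> R) (f : n.-tuple T -> \bar R) :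
  (0 < a)%R -> measurable_fun setT f -> (forall t, 0 <= f t) ->
  \int[mu n]_t f (affine_tuple a v t) = (a ^- n)%:E * \int[mu n]_t f t.
Proof.
move=> a0; elim: n v f => [|n IH] v f mf f0.
  rewrite expr0 invr1 mul1e; apply: eq_integral => t _.
  by rewrite (tuple0 t) (tuple0 (affine_tuple _ _ _)).
have mfa : measurable_fun setT (f \o affine_tuple a v).
  exact: measurableT_comp mf (measurable_affine_tuple _ _).
have mfc x : measurable_fun setT (fun t : n.-tuple T => f (cons_pair (x, t))).
  apply: (measurableT_comp mf).
  apply: (measurableT_comp measurable_cons_pair); exact: pair1_measurable.
rewrite !integral_lebesgue_tupleS //.
pose F x := \int[mu n]_t f (cons_pair (x, t)).
have mF : measurable_fun setT F.
  apply: (@measurable_fun_fubini_tonelli_F _ _ _ _ _ (mu n) (f \o cons_pair)) => //=.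
  exact: measurableT_comp mf measurable_cons_pair.
have F0 x : 0 <= F x by apply: integral_ge0.
transitivity (\int[lebesgue_measure]_x ((a ^- n)%:E * F (a * x + v ord0)%R)).
  apply: eq_integral => x _.
  rewrite -(IH (fun i => v (lift ord0 i))
    (fun t => f (cons_pair ((a * x + v ord0)%R, t)))) //.
  apply: eq_integral => t _; congr f; apply: eq_from_tnth => i.
  rewrite tnth_mktuple /cons_pair.
  by case: (unliftP ord0 i) => [j|] ->; rewrite ?tnthS ?tnth0 ?tnth_mktuple.
rewrite ge0_integralZl_EFin ?invr_ge0 ?exprn_ge0 ?(ltW a0) //.
  by rewrite integral_affine // muleA -EFinM exprS invfM mulrC.
apply: (measurableT_comp mF) => //.
by apply: measurable_funD => //; apply: measurable_funM.
Qed.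

End LebesgueTuple.

Section RowIntegral.
Context {R : realType}.
Local Open Scope ereal_scope.
Local Notation T := (measurableTypeR R).
Local Notation mu := (lebesgue_tuple R).

(** The measure lives on tuples, whereas matrices and [dot] act on row vectors; measurability and
    integrals are pulled back along [row_of_tuple]. *)
Definition row_measurable n (g : 'rV[R]_n -> R) : Prop :=
  measurable_fun setT (fun t : n.-tuple T => g (row_of_tuple t)).

Definition row_integral n (g : 'rV[R]_n -> R) : \bar R :=
  \int[mu n]_t (g (row_of_tuple t))%:E.

Lemma row_measurable_comp d (X : measurableType d) n (g : 'rV[R]_n -> R)
    (h : X -> 'rV[R]_n) :
  row_measurable g -> (forall i, measurable_fun setT (fun x => h x ord0 i)) ->
  measurable_fun setT (g \o h).
Proof.
(* Measurability of [g] is known only on tuples, so [h] is factored through the tuple of its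
   coordinates. *)
move=> mg mh; pose k x : n.-tuple T := [tuple h x ord0 i | i < n].
have mk : measurable_fun setT k.
  apply/measurable_fun_tnthP => i.
  rewrite (_ : _ \o _ = (fun x => h x ord0 i)); first exact: mh.
  by apply/funext => x /=; rewrite tnth_mktuple.
rewrite (_ : g \o h = (fun t : n.-tuple T => g (row_of_tuple t)) \o k).
  exact: measurableT_comp mg mk.
apply/funext => x /=; congr g; apply/rowP => i.
by rewrite mxE tnth_mktuple.
Qed.

Lemma measurable_row_lin m n (A : 'M[R]_(m, n)) i :
  measurable_fun setT (fun t : m.-tuple T => (row_of_tuple t *m A)%R ord0 i).
Proof.
under [X in measurable_fun _ X]eq_fun do rewrite mxE.
apply: measurable_sum => j; apply: measurable_funM => //.
under [X in measurable_fun _ X]eq_fun do rewrite mxE.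
exact: measurable_tnth.
Qed.

Lemma row_measurable_affine m n (g : 'rV[R]_n -> R) (A : 'M[R]_(m, n)) v :
  row_measurable g -> row_measurable (fun x => g (x *m A + v)%R).
Proof.
move=> mg; apply: (row_measurable_comp mg) => i.
under [X in measurable_fun _ X]eq_fun do rewrite mxE.
by apply: measurable_funD => //; exact: measurable_row_lin.
Qed.

Lemma row_measurable_lin m n (g : 'rV[R]_n -> R) (A : 'M[R]_(m, n)) :
  row_measurable g -> row_measurable (fun x => g (x *m A)%R).
Proof.
move=> mg; have := row_measurable_affine A 0%R mg.
by under eq_fun do rewrite addr0.
Qed.

Lemma row_measurable_scale n (g : 'rV[R]_n -> R) (a : R) :
  row_measurable g -> row_measurable (fun x => g (a *: x)%R).
Proof.
move=> mg; have := row_measurable_lin (a%:M)%R mg.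
by under eq_fun do rewrite mul_mx_scalar.
Qed.

Lemma row_measurable_shift n (g : 'rV[R]_n -> R) (v : 'rV[R]_n) :
  row_measurable g -> row_measurable (fun x => g (x + v)%R).
Proof.
move=> mg; have := row_measurable_affine 1%:M%R v mg.
by under eq_fun do rewrite mulmx1.
Qed.

Lemma row_measurableM n (g h : 'rV[R]_n -> R) :
  row_measurable g -> row_measurable h -> row_measurable (fun x => g x * h x)%R.
Proof. by move=> mg mh; apply: measurable_funM. Qed.

Lemma row_integral_affine n (a : R) (v : 'rV[R]_n) (g : 'rV[R]_n -> R) :
  (0 < a)%R -> row_measurable g -> (forall x, 0 <= g x)%R ->
  row_integral (fun x => g (a *: x + v)%R) = (a ^- n)%:E * row_integral g.
Proof.
move=> a0 mg g0.
rewrite /row_integral -(integral_affine_tuple (v ord0) a0); first last.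
- by move=> t; rewrite lee_fin.
- exact: measurableT_comp mg.
apply: eq_integral => t _; congr EFin; congr g; apply/rowP => i.
by rewrite !mxE tnth_mktuple.
Qed.

Lemma row_integral_dilate n (a : R) (g : 'rV[R]_n -> R) :
  (0 < a)%R -> row_measurable g -> (forall x, 0 <= g x)%R ->
  row_integral (fun x => g (a *: x)%R) = (a ^- n)%:E * row_integral g.
Proof.
move=> a0 mg g0; under [in LHS]eq_fun do rewrite -[(_ *: _)%R]addr0.
exact: row_integral_affine.
Qed.

Lemma row_integral_shift n (v : 'rV[R]_n) (g : 'rV[R]_n -> R) :
  row_measurable g -> (forall x, 0 <= g x)%R ->
  row_integral (fun x => g (x + v)%R) = row_integral g.
Proof.
move=> mg g0; have := row_integral_affine v ltr01 mg g0.
under eq_fun do rewrite scale1r.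
by rewrite expr1n invr1 mul1e.
Qed.

Lemma le_row_integral n (g h : 'rV[R]_n -> R) :
  row_measurable g -> row_measurable h -> (forall x, 0 <= g x)%R ->
  (forall x, g x <= h x)%R -> row_integral g <= row_integral h.
Proof.
move=> mg mh g0 gh; apply: ge0_le_integral => //.
- by move=> t _; rewrite lee_fin.
- exact: measurableT_comp mg.
- exact: measurableT_comp mh.
- by move=> t _; rewrite lee_fin.
Qed.

Lemma row_integralZl n (k : R) (g : 'rV[R]_n -> R) :
  (0 <= k)%R -> row_measurable g -> (forall x, 0 <= g x)%R ->
  row_integral (fun x => k * g x)%R = k%:E * row_integral g.
Proof.
move=> k0 mg g0; rewrite /row_integral.
under eq_integral => t _ do rewrite EFinM.
rewrite ge0_integralZl_EFin //; last exact: measurableT_comp mg.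
by move=> t _; rewrite lee_fin.
Qed.

Definition box n (e : R) : set 'rV[R]_n := [set x | forall i, `|x ord0 i| <= e]%R.

Lemma measurable_box n e :
  measurable [set t : n.-tuple T | box e (row_of_tuple t)].
Proof.
rewrite (_ : [set _ | _] =
    \bigcap_(i in [set: 'I_n]) ((@tnth n _)^~ i @^-1` `[(- e)%R, e]%classic)).
  apply: fin_bigcap_measurable => // i _.
  by rewrite -[X in measurable X]setTI; apply: measurable_tnth.
apply/seteqP; split => [t h i _|t h i].
  by have := h i; rewrite mxE /= in_itv /= ler_norml.
by have := h i Logic.I; rewrite /= mxE in_itv /= ler_norml.
Qed.

Lemma row_measurable_box n e : row_measurable (\1_(@box n e)).
Proof.
rewrite /row_measurable.
rewrite (_ : (fun t => _) = \1_[set t : n.-tuple T | box e (row_of_tuple t)]).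
  have mb := @measurable_box n e. exact: (@measurable_indic _ _ R setT _ mb).
by apply/funext => t; rewrite !indicE.
Qed.

Lemma row_integral_box n (e : R) : (0 <= e)%R ->
  row_integral (\1_(@box n e)) = ((2 * e) ^+ n)%:E.
Proof.
move=> e0; rewrite /row_integral.
rewrite (_ : (fun t => _) =
    (fun t => (\1_[set t : n.-tuple T | box e (row_of_tuple t)] t)%:E)); last first.
  by apply/funext => t; rewrite !indicE.
rewrite integral_indic //; last exact: measurable_box.
rewrite setIT.
rewrite (_ : [set _ | _] =
    [set t | forall i, `[(- e)%R, e]%classic (tnth t i)]); last first.
  by apply/seteqP; split => t h i; have := h i; rewrite mxE /= in_itv /= ler_norml.
transitivity (\prod_(i < n) lebesgue_measure (`[(- e)%R, e]%classic : set T)).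
  by rewrite -lebesgue_tuple_box.
rewrite (eq_bigr (fun _ => (2 * e)%:E)).
  by rewrite prodEFin big_const_ord; congr EFin; elim: n => //= n ->; rewrite exprS.
move=> i _; rewrite lebesgue_measure_itv /= lte_fin.
(* The degenerate interval occurs only for [e = 0], where [2 * e] vanishes too. *)
case: ltP; first by rewrite -EFinB opprK -mulr2n mulr_natl.
by move=> h; congr EFin; lra.
Qed.

End RowIntegral.

(** * Integrals along the fibres of a projection *)

Section Fibers.
Context {R : realType}.
Local Open Scope ereal_scope.
Local Notation T := (measurableTypeR R).
Local Notation mu := (lebesgue_tuple R).

(** The constant dominates every column sum of moduli; the summand 1 keeps it at least 1 even for
    [A = 0], so that it can be divided by. *)
Lemma mulmx_box m n (A : 'M[R]_(m, n)) :
  exists2 beta : R, (1 <= beta)%R &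
    forall (e : R) x, (0 <= e)%R -> box e x -> box (beta * e)%R (x *m A)%R.
Proof.
exists (1 + \sum_j \sum_i `|A i j|)%R.
  by rewrite lerDl; apply: sumr_ge0 => i _; apply: sumr_ge0.
move=> e x e0 xe j; rewrite mxE (le_trans (ler_norm_sum _ _ _)) //.
rewrite (bigD1 j) //= addrCA mulrDl -[leLHS]addr0 lerD //; last first.
  by rewrite mulr_ge0 // addr_ge0 //; apply: sumr_ge0 => i _; apply: sumr_ge0.
rewrite mulr_suml; apply: ler_sum => i _.
by rewrite normrM mulrC ler_wpM2l.
Qed.

Lemma box_add n (a b e : R) (x y : 'rV[R]_n) :
  box a x -> box b y -> (a + b <= e)%R -> box e (x + y)%R.
Proof.
move=> ax yb abe i; rewrite mxE (le_trans (ler_normD _ _)) //.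
by rewrite (le_trans _ abe) // lerD.
Qed.

Lemma boxN n (e : R) (x : 'rV[R]_n) : box e x -> box e (- x)%R.
Proof. by move=> ex i; rewrite mxE normrN. Qed.

Lemma le_box n (d e : R) (x : 'rV[R]_n) : (d <= e)%R -> box d x -> box e x.
Proof. by move=> de dx i; rewrite (le_trans (dx i)). Qed.

Lemma le_indic_box n m (d e : R) (x : 'rV[R]_n) (y : 'rV[R]_m) (a : R) :
  (0 <= a)%R -> (box d x -> box e y) -> (\1_(box d) x * a <= \1_(box e) y * a)%R.
Proof.
move=> a0 h; rewrite !indicE; have [|] := boolP (x \in _).
  by move=> /set_mem /h /mem_set ->.
by rewrite mul0r mulr_ge0.
Qed.

Lemma measurable_box_cst n (e : R) (c : \bar R) :
  measurable_fun setT
    (fun t : n.-tuple T => (\1_(box e) (row_of_tuple t))%:E * c).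
Proof.
apply: emeasurable_funM => //; apply: measurableT_comp => //.
exact: row_measurable_box.
Qed.

Lemma integral_box_cst n (e : R) (c : \bar R) : (0 <= e)%R -> 0 <= c ->
  \int[mu n]_t ((\1_(box e) (row_of_tuple t))%:E * c) = ((2 * e) ^+ n)%:E * c.
Proof.
move=> e0 c0; rewrite ge0_integralZr //.
- by congr (_ * c); exact: row_integral_box.
- by apply: measurableT_comp => //; exact: row_measurable_box.
Qed.

(* Averaging over translates of the fibres of [z |-> z *m B^T] replaces a linear
   change of variables: for small [y], moving [z] by [y *m B] keeps it in the box
   and shifts [z *m B^T] by [y]. *)
Lemma integral_box_fiber n N (B : 'M[R]_(n, N)) (e : R) :
  B *m B^T = 1%:M -> (0 < e)%R ->
  exists2 d : R, (0 < d)%R & exists2 K : R, (0 <= K)%R &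
    forall G : 'rV[R]_n -> R, row_measurable G -> (forall y, 0 <= G y)%R ->
      row_integral (fun y => \1_(box d) y * G y)%R <=
      K%:E * row_integral (fun z : 'rV[R]_N => \1_(box e) z * G (z *m B^T))%R.
Proof.
move=> BB e0.
have [b1 b1_ge1 hB] := mulmx_box B; have [b2 b2_ge1 hBt] := mulmx_box B^T.
pose b := Num.max b1 b2.
have b_ge1 : (1 <= b)%R by rewrite le_max b1_ge1.
have b0 : (0 < b)%R by rewrite (lt_le_trans ltr01).
(* The radii are chosen so that [y *m B] stays in the box of radius [2 * d * b = e / 2] for [y] in
   [box (2 * d)], and [x *m B^T] in that of radius [eta * b = d] for [x] in [box eta]. *)
pose d := (e / (4 * b))%R; pose eta := (d / b)%R.
have d0 : (0 < d)%R by rewrite divr_gt0 // mulr_gt0.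
have eta0 : (0 < eta)%R by rewrite divr_gt0.
have dbE : (d * b = e / 4)%R by rewrite /d; field; rewrite gt_eqF.
have ebE : (eta * b = d)%R by rewrite /eta; field; rewrite gt_eqF.
clearbody eta d; have dbe : (eta + e / 2 <= e)%R.
  have h1 : (eta <= d)%R by rewrite -[leRHS]ebE ler_peMr // ltW.
  have h2 : (d <= e / 4)%R by rewrite -[leRHS]dbE ler_peMr // ltW.
  lra.
(* [V] is the volume of [box (2 * d)] in dimension [n], [U] that of [box eta] in dimension [N]. *)
exists d => //; pose V := ((2 * (2 * d)) ^+ n)%R; pose U := ((2 * eta) ^+ N)%R.
have V0 : (0 <= V)%R by rewrite exprn_ge0 // !mulr_ge0 // ltW.
have U0 : (0 < U)%R by rewrite exprn_gt0 // mulr_gt0.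
exists (V / U)%R; first by rewrite divr_ge0 // ltW.
move=> G mG G0.
set I := row_integral _; set J := row_integral _.
have I0 : 0 <= I by apply: integral_ge0 => y _; rewrite lee_fin mulr_ge0.
have J0 : 0 <= J by apply: integral_ge0 => y _; rewrite lee_fin mulr_ge0.
have hBV y : box (2 * d) y -> box (e / 2)%R (y *m B).
  move=> yd; apply: le_box (hB _ _ _ yd); last by rewrite ltW ?mulr_gt0.
  rewrite mulrC -mulrA (_ : e / 2 = 2 * (d * b))%R; last by rewrite dbE; field.
  by rewrite !ler_pM2l // le_max lexx.
have hBtU x : box eta x -> box d (x *m B^T).
  move=> xe; apply: le_box (hBt _ _ _ xe); last by rewrite ltW.
  by rewrite mulrC -[leRHS]ebE ler_pM2l // le_max lexx orbT.
(* The double integral of [F] is bounded above by [V * J] when integrating over [x] first, and below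
   by [U * I] when integrating over [y] first; Tonelli compares the two. *)
pose F (p : (n.-tuple T * N.-tuple T)%type) : \bar R :=
  (\1_(box (2 * d)) (row_of_tuple p.1) *
   (\1_(box eta) (row_of_tuple p.2) *
    G (row_of_tuple p.2 *m B^T + row_of_tuple p.1)))%:E.
have mfst i : measurable_fun setT
    (fun p : (n.-tuple T * N.-tuple T)%type => row_of_tuple p.1 ord0 i).
  under [X in measurable_fun _ X]eq_fun do rewrite !mxE.
  exact: (measurableT_comp (measurable_tnth i) measurable_fst).
have msnd i : measurable_fun setT
    (fun p : (n.-tuple T * N.-tuple T)%type => row_of_tuple p.2 ord0 i).
  under [X in measurable_fun _ X]eq_fun do rewrite !mxE.
  exact: (measurableT_comp (measurable_tnth i) measurable_snd).
have mF : measurable_fun setT F.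
  apply: measurableT_comp => //; apply: measurable_funM.
    exact: row_measurable_comp (row_measurable_box _) mfst.
  apply: measurable_funM.
    exact: row_measurable_comp (row_measurable_box _) msnd.
  apply: (row_measurable_comp mG) => i.
  under [X in measurable_fun _ X]eq_fun do rewrite mxE.
  apply: measurable_funD => //.
  exact: (measurableT_comp (measurable_row_lin B^T i) measurable_snd).
have F0 p : 0 <= F p.
  by rewrite lee_fin !mulr_ge0.
(* For fixed [y], the integrand of [J] is translated by [y *m B], which turns [x *m B^T] into
   [x *m B^T + y] because [B *m B^T = 1]. *)
have F1 : \int[mu n]_y \int[mu N]_x F (y, x) <= V%:E * J.
  have -> : V%:E * J = \int[mu n]_y ((\1_(box (2 * d)) (row_of_tuple y))%:E * J).
    by rewrite integral_box_cst // mulr_ge0 // ltW.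
  apply: ge0_le_integral => //.
  - by move=> y _; apply: integral_ge0.
  - exact: (measurable_fun_fubini_tonelli_F F).
  - exact: measurable_box_cst.
  move=> y _; set yr := row_of_tuple y.
  rewrite [leLHS](_ : _ = row_integral (fun x =>
      \1_(box (2 * d)) yr * (\1_(box eta) x * G (x *m B^T + yr)))%R) //.
  rewrite row_integralZl //; last first.
  + by move=> x; rewrite mulr_ge0.
  + exact: row_measurableM (row_measurable_box _) (row_measurable_affine _ _ mG).
  rewrite indicE; have [/set_mem yV|_] := boolP (yr \in _); last by rewrite !mul0e.
  rewrite !mul1e /J -[leRHS](row_integral_shift (yr *m B)); first last.
  + by move=> x; rewrite mulr_ge0.
  + exact: row_measurableM (row_measurable_box _) (row_measurable_lin _ mG).
  apply: le_row_integral.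
  + exact: row_measurableM (row_measurable_box _) (row_measurable_affine _ _ mG).
  + apply: (@row_measurable_shift _ _ (fun x => \1_(box e) x * G (x *m B^T)))%R.
    exact: row_measurableM (row_measurable_box _) (row_measurable_lin _ mG).
  + by move=> x; rewrite mulr_ge0.
  + move=> x; rewrite mulmxDl -mulmxA BB mulmx1; apply: le_indic_box => // xe.
    by apply: (box_add xe (hBV _ yV)); rewrite dbe.
(* For fixed [x] in [box eta], the integrand of [I] is translated by [x *m B^T]; a point landing in
   [box d] started in [box (2 * d)]. *)
have F2 : U%:E * I <= \int[mu N]_x \int[mu n]_y F (y, x).
  have -> : U%:E * I = \int[mu N]_x ((\1_(box eta) (row_of_tuple x))%:E * I).
    by rewrite integral_box_cst // ltW.
  apply: ge0_le_integral => //.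
  - by move=> x _; rewrite mule_ge0 ?lee_fin.
  - exact: measurable_box_cst.
  - exact: (measurable_fun_fubini_tonelli_G F).
  move=> x _; set xr := row_of_tuple x.
  rewrite [leRHS](_ : _ = row_integral (fun y =>
      \1_(box (2 * d)) y * (\1_(box eta) xr * G (y + xr *m B^T)))%R); last first.
    by apply: eq_integral => y _; rewrite /F /= [(_ *m _ + _)%R]addrC.
  rewrite [\1_(box eta) xr]indicE; have [/set_mem xU|_] := boolP (xr \in _); last first.
    by rewrite mul0e integral_ge0 // => y _; rewrite lee_fin mulr_ge0 // mul0r.
  rewrite mul1e /I [leRHS](_ : _ = row_integral (fun y =>
      \1_(box (2 * d)) y * G (y + xr *m B^T)))%R; last first.
    by congr row_integral; apply/funext => y; rewrite mul1r.
  rewrite -[leLHS](row_integral_shift (xr *m B^T)); first last.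
  + by move=> y; rewrite mulr_ge0.
  + exact: row_measurableM (row_measurable_box _) mG.
  apply: le_row_integral.
  + apply: (@row_measurable_shift _ _ (fun y => \1_(box d) y * G y))%R.
    exact: row_measurableM (row_measurable_box _) mG.
  + apply: row_measurableM (row_measurable_box _) _.
    exact: (row_measurable_shift _ mG).
  + by move=> y; rewrite mulr_ge0.
  + move=> y; apply: le_indic_box => // yd.
    by rewrite -[y](addrK (xr *m B^T)); apply: (box_add yd (boxN (hBtU _ xU))); lra.
have UI : U%:E * I <= V%:E * J.
  apply: (le_trans F2); apply: le_trans F1.
  have := fubini_tonelli (m1 := mu n) (m2 := mu N) F mF F0.
  by rewrite /fubini_F /fubini_G => ->.
rewrite mulrC EFinM -muleA -(lee_pmul2l _ (_ : 0 < U%:E)) //.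
by rewrite muleA -EFinM divff ?mul1e // gt_eqF.
Qed.

End Fibers.

(** * Dilations of boxes *)

Section DilatedBoxes.
Context {R : realType}.

Lemma indic_boxZ n (r d : R) (y : 'rV[R]_n) : 0 < r ->
  \1_(box (r * d)) (r *: y) = \1_(box d) y :> R.
Proof.
move=> r0; rewrite !indicE; congr (nat_of_bool _)%:R.
apply/idP/idP => /set_mem h; apply/mem_set => i; have := h i.
  by rewrite mxE normrM gtr0_norm // ler_pM2l.
by rewrite mxE normrM gtr0_norm // ler_pM2l.
Qed.

(** Substituting [r *: y] brings the growing box back to the fixed [box d]; [r ^+ n] is the Jacobian
    and [l] the factor by which the integrand scales. *)
Lemma row_integral_box_dilate n (G H : 'rV[R]_n -> R) (r d l : R) :
  0 < r -> 0 <= l -> row_measurable G -> row_measurable H ->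
  (forall y, 0 <= G y) -> (forall y, 0 <= H y) ->
  (forall y, G (r *: y) = l * H y) ->
  (row_integral (fun y => \1_(box (r * d)) y * G y)%R =
   (r ^+ n * l)%:E * row_integral (fun y => \1_(box d) y * H y)%R)%E.
Proof.
move=> r0 l0 mG mH G0 H0 GH.
pose g y := \1_(box (r * d)) y * G y; pose h y := \1_(box d) y * H y.
have mg : row_measurable g by apply: row_measurableM mG; exact: row_measurable_box.
have mh : row_measurable h by apply: row_measurableM mH; exact: row_measurable_box.
have g0 y : 0 <= g y by exact: mulr_ge0.
have h0 y : 0 <= h y by exact: mulr_ge0.
have := row_integral_dilate r0 mg g0.
have -> : (fun y => g (r *: y)) = (fun y => l * h y).
  by apply/funext => y; rewrite /g /h indic_boxZ // GH mulrCA.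
rewrite (row_integralZl l0 mh h0) => gI.
rewrite EFinM -muleA gI muleA -EFinM divff ?mul1e //.
by rewrite expf_neq0 // gt_eqF.
Qed.

End DilatedBoxes.

(** * From dyadic boxes to Gaussian convergence *)

Section Gaussian.
Context {R : realType}.
Local Notation T := (measurableTypeR R).

Lemma row_measurable_coord n (i : 'I_n) : row_measurable (fun x : 'rV[R]_n => x 0 i).
Proof.
rewrite /row_measurable; under eq_fun do rewrite mxE.
exact: measurable_tnth.
Qed.

Lemma row_measurable_dot n (f g : 'rV[R]_n -> 'rV[R]_n) :
  (forall i, row_measurable (fun x => f x 0 i)) ->
  (forall i, row_measurable (fun x => g x 0 i)) ->
  row_measurable (fun x => dot (f x) (g x)).
Proof.
move=> mf mg; apply: measurable_sum => i.
by apply: measurable_funM; [exact: mf|exact: mg].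
Qed.

Lemma row_measurable_gaussian n :
  row_measurable (fun y : 'rV[R]_n => expR (- (1 / 2) * dot y y)).
Proof.
apply: measurableT_comp; first exact: measurable_expR.
apply: measurable_funM => //.
exact: (@row_measurable_dot n id id (@row_measurable_coord n)
  (@row_measurable_coord n)).
Qed.

(** Take the least [j] whose box contains [y]. If [j > 0], some coordinate exceeds half the radius,
    so the Gaussian is exponentially small in [2 ^+ j] and beats any fixed power. *)
Lemma gaussian_le_dyadic n (d : R) (E : nat) : 0 < d ->
  exists2 C : R, 0 <= C & forall y : 'rV[R]_n, exists2 j : nat,
    box (2 ^+ j * d) y & expR (- (1 / 2) * dot y y) <= C / (2 ^+ E.+1) ^+ j.
Proof.
move=> d0; pose a := d ^+ 2 / 2.
have a0 : 0 < a by rewrite divr_gt0 // exprn_gt0.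
exists (1 + (2 / a) ^+ E.+1 * (E.+1)`!%:R).
  by rewrite addr_ge0 // mulr_ge0 // exprn_ge0 // divr_ge0 // ltW.
move=> y; pose P j := [forall i, `|y ord0 i| <= 2 ^+ j * d].
have exP : exists j, P j.
  pose s := (\sum_i `|y ord0 i|) / d.
  (* By [upper_nthrootP], 2 raised to the Archimedean bound of [s] exceeds [s]. *)
  exists (Num.Def.archi_bound s); apply/forallP => i.
  rewrite -ler_pdivrMr // (@le_trans _ _ s) //; last first.
    exact/ltW/upper_nthrootP.
  rewrite ler_pM2r ?invr_gt0 // (bigD1 i) //= lerDl.
  by apply: sumr_ge0 => k _.
case: (ex_minnP exP) => j /forallP Pj jmin; exists j => //.
have c2 : 0 <= (2 / a) ^+ E.+1 * (E.+1)`!%:R.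
  by rewrite mulr_ge0 // exprn_ge0 // divr_ge0 // ltW.
have yy0 : 0 <= dot y y by apply: sumr_ge0 => i _; rewrite -expr2 sqr_ge0.
case: j Pj jmin => [|j] Pj jmin.
  rewrite expr0 divr1 (@le_trans _ _ 1) ?lerDl //.
  by rewrite -expR0 ler_expR mulNr oppr_le0 mulr_ge0.
have [k yk] : exists k, 2 ^+ j * d < `|y ord0 k|.
  apply: contrapT => /forallNP h; have /jmin : P j; last by rewrite ltnn.
  by apply/forallP => k; rewrite leNgt; apply/negP/h.
set x := 1 / 2 * dot y y.
have xa : 2 ^+ j * a <= x.
  have : (2 ^+ j * d) ^+ 2 <= dot y y.
    rewrite /dot (bigD1 k) //= -[leLHS]addr0 lerD //.
      rewrite -expr2 -(real_normK (num_real (y _ k))) ler_pXn2r ?nnegrE //.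
        exact: ltW.
      by rewrite mulr_ge0 ?exprn_ge0 // ltW.
    by apply: sumr_ge0 => i _; rewrite -expr2 sqr_ge0.
  rewrite exprMn /x /a => h.
  (* The true growth [4 ^ j] of [x] is weakened to [2 ^ j], enough for decay faster than any
     power. *)
  have h2 : 2 ^+ j <= (2 ^+ j) ^+ 2 :> R.
    by rewrite expr2 ler_peMr ?exprn_ge0 // exprn_ege1 // ler1n.
  rewrite mulrA mulrC div1r ler_pM2l ?invr_gt0 //.
  by apply: le_trans h; rewrite ler_pM2r // exprn_gt0.
have x0 : 0 <= x by apply: le_trans xa; rewrite mulr_ge0 ?exprn_ge0 // ltW.
rewrite mulNr -/x expRN ler_pdivlMr ?exprn_gt0 // mulrC ler_pdivrMr ?expR_gt0 //.
rewrite mulrDl mul1r (@le_trans _ _ ((2 / a) ^+ E.+1 * (E.+1)`!%:R * expR x)) //;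
  last first.
  by rewrite lerDr expR_ge0.
have ex : x ^+ E.+1 <= (E.+1)`!%:R * expR x.
  rewrite mulrC -ler_pdivrMr ?ltr0n ?fact_gt0 //.
  by apply: le_trans (expR_ge1Dxn E x0); rewrite lerDr.
rewrite -mulrA (@le_trans _ _ ((2 / a) ^+ E.+1 * x ^+ E.+1)) //; last first.
  by rewrite ler_wpM2l // exprn_ge0 // divr_ge0 // ltW.
rewrite -exprMn -exprM mulnC exprM ler_pXn2r ?nnegrE ?exprn_ge0 //; last first.
  by rewrite mulr_ge0 // divr_ge0 // ltW.
rewrite exprS -mulrA ler_pM2l //.
by rewrite mulrC ler_pdivlMr.
Qed.

Local Open Scope ereal_scope.

(** The Gaussian is dominated by a series of weighted indicators of dyadic boxes. Its weights decay
    one power of [2 ^+ j] faster than the box integrals grow, so the integrated series is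
    geometric. *)
Lemma gaussian_integral_lt_pinfty n (d : R) (K : R) (E : nat) (G : 'rV[R]_n -> R) :
  (0 < d)%R -> row_measurable G -> (forall y, 0 <= G y)%R ->
  (forall j : nat, row_integral (fun y => \1_(box (2 ^+ j * d)) y * G y)%R <=
     (K * (2 ^+ E) ^+ j)%:E) ->
  row_integral (fun y => G y * expR (- (1 / 2) * dot y y))%R < +oo.
Proof.
move=> d0 mG G0 GK; have [C C0 hC] := @gaussian_le_dyadic n d E d0.
pose u j (y : 'rV[R]_n) := (C / (2 ^+ E.+1) ^+ j * (\1_(box (2 ^+ j * d)) y * G y))%R.
have mB j : row_measurable (fun y => \1_(box (2 ^+ j * d)) y * G y)%R.
  exact: row_measurableM (row_measurable_box _) mG.
have q0 j : (0 <= C / (2 ^+ E.+1) ^+ j)%R by rewrite divr_ge0 // !exprn_ge0.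
have mu j : row_measurable (u j) by apply: measurable_funM => //; exact: mB.
have u0 j y : (0 <= u j y)%R by rewrite !mulr_ge0.
(* The bound is [C * K / 2 ^ j], written in the shape of [cvg_geometric_eseries_half]. *)
have Iu j : row_integral (u j) <= ((C * K * 2) / (2 ^ (j + 1))%:R)%:E.
  rewrite row_integralZl //; last by move=> y; rewrite mulr_ge0.
  apply: le_trans (lee_pmul _ _ (le_refl _) (GK j)) _; rewrite ?lee_fin //.
    by apply: integral_ge0 => t _; rewrite lee_fin mulr_ge0.
  rewrite natrX -!exprM mulSn exprD addn1 exprS.
  rewrite le_eqVlt; apply/orP; left; apply/eqP; field.
  by rewrite !expf_neq0.
apply: (@le_lt_trans _ _ (\sum_(0 <= j <oo) row_integral (u j))).
  rewrite /row_integral -integral_nneseries //; first last.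
  - by move=> j t _; rewrite lee_fin.
  - by move=> j; apply: measurableT_comp => //; exact: mu.
  apply: ge0_le_integral => //.
  - by move=> t _; rewrite lee_fin mulr_ge0 // expR_ge0.
  - apply: measurableT_comp => //.
    by apply: measurable_funM; [exact: mG|exact: row_measurable_gaussian].
  - apply: (@ge0_emeasurable_sum _ _ _ setT
      (fun j t => (u j (row_of_tuple t))%:E) xpredT) => // j *.
      by rewrite lee_fin.
    by apply: measurableT_comp => //; exact: mu.
  move=> t _; set y := row_of_tuple t; have [j yj hj] := hC y.
  (* The single term whose index [j] comes from [hC] already dominates at [y]. *)
  apply: (@le_trans _ _ (u j y)%:E).
    have -> : u j y = (C / (2 ^+ E.+1) ^+ j * G y)%R.
      by rewrite /u [\1_(box _) y]indicE mem_set // [(true%:R * _)%R]mul1r.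
    by rewrite lee_fin mulrC ler_wpM2r.
  apply: (@le_trans _ _ (\sum_(0 <= i < j.+1) (u i y)%:E)).
    rewrite big_nat_recr //= leeDr //.
    by apply: sume_ge0 => i _; rewrite lee_fin.
  by apply: nneseries_lim_ge => i _ _; rewrite lee_fin.
apply: (@le_lt_trans _ _ (\sum_(0 <= j <oo) ((C * K * 2) / (2 ^ (j + 1))%:R)%:E)).
  apply: lee_nneseries => // j _ _.
  by apply: integral_ge0 => t _; rewrite lee_fin.
have := @cvg_geometric_eseries_half R (C * K * 2) 0.
by move=> /cvg_lim -> //; rewrite ltry.
Qed.

End Gaussian.

(** * Homogeneous components and dilates *)

Section NormSquare.
Context {R : realType}.
Local Open Scope complex_scope.
Implicit Types z : R[i].

Definition normsq z : R := Normc.normc z ^+ 2.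

Lemma normsq_ge0 z : 0 <= normsq z.
Proof. exact: sqr_ge0. Qed.

Lemma normsqE z : normsq z = complex.Re z ^+ 2 + complex.Im z ^+ 2.
Proof. by case: z => a c; rewrite /normsq /= sqr_sqrtr // addr_ge0 // sqr_ge0. Qed.

Lemma normsqM z1 z2 : normsq (z1 * z2) = normsq z1 * normsq z2.
Proof. by rewrite /normsq Normc.normcM exprMn. Qed.

Lemma normsq_real (a : R) : normsq a%:C = a ^+ 2.
Proof. by rewrite normsqE /= expr0n addr0. Qed.

(** Parallelogram identity: the two sides differ by the squared modulus of [z1 - z2]. *)
Lemma normsqD z1 z2 : normsq (z1 + z2) <= 2 * (normsq z1 + normsq z2).
Proof.
case: z1 z2 => [a1 c1] [a2 c2]; rewrite !normsqE /= -subr_ge0.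
rewrite (_ : _ - _ = (a1 - a2) ^+ 2 + (c1 - c2) ^+ 2); last by ring.
by rewrite addr_ge0 // sqr_ge0.
Qed.

Lemma normsq_sum n (f : 'I_n -> R[i]) :
  normsq (\sum_i f i) <= 2 ^+ n * \sum_i normsq (f i).
Proof.
elim: n f => [|n IH] f; first by rewrite !big_ord0 mulr0 normsqE /= expr0n addr0.
rewrite !big_ord_recl (le_trans (normsqD _ _)) // exprS -mulrA ler_pM2l //.
rewrite mulrDr lerD ?IH // ler_peMl ?normsq_ge0 //.
by rewrite exprn_ege1 // ler1n.
Qed.

End NormSquare.

Section Homogeneous.
Context {R : realType} {N : nat}.
Local Open Scope complex_scope.
Local Notation P := (mpoly N R[i]).
Implicit Types (p q : P) (x : 'rV[R]_N).

Lemma eval_homog_scale d q (s : R) x :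
  pihomog mdeg d q = q -> Defs.eval q (s *: x) = (s ^+ d)%:C * Defs.eval q x.
Proof.
move=> hq; have /dhomogP hd : q \is ishomog1 d mdeg by rewrite -hq pihomogP.
rewrite /Defs.eval !mevalE mulr_sumr; apply: eq_big_seq => m /hd dm.
rewrite mulrCA; congr (_ * _).
have -> : d = (\sum_i m i)%N by rewrite -mdegE; exact: esym.
rewrite -prodrXr rmorph_prod -big_split /=; apply: eq_bigr => i _.
by rewrite mxE rmorphM exprMn rmorphXn.
Qed.

Lemma eval_scale W p (s : R) x : (msize p <= W)%N ->
  Defs.eval p (s *: x) =
  \sum_(d < W) (s ^+ d)%:C * Defs.eval (pihomog mdeg d p) x.
Proof.
move=> pW; rewrite {1}(pihomog_partitionE pW) /Defs.eval raddf_sum.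
apply: eq_bigr => d _; apply: eval_homog_scale.
by apply: pihomog_dE; exact: pihomogP.
Qed.

(* Inverting a Vandermonde matrix recovers the homogeneous components from the
   values at finitely many dilates. *)
Lemma normsq_pihomog_le W : exists2 C : R, 0 <= C &
  forall p d x, (msize p <= W)%N -> (d < W)%N ->
    normsq (Defs.eval (pihomog mdeg d p) x) <=
    C * \sum_(j < W) normsq (Defs.eval p (j.+1%:R^-1 *: x)).
Proof.
(* These nodes are distinct, which makes the Vandermonde matrix invertible, and lie in []0, 1]], so
   that the dilations map every box into itself. *)
pose t (j : 'I_W) : R := j.+1%:R^-1.
pose V : 'M[R[i]]_W := Vandermonde W (\row_j (t j)%:C).
have Vu : V \in unitmx.
  rewrite unitmxE det_Vandermonde unitfE; apply/prodf_neq0 => i _.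
  apply/prodf_neq0 => j ij; rewrite !mxE -rmorphB /=.
  rewrite (inj_eq (@complexI R) _ 0) subr_eq0 (inj_eq invr_inj) eqr_nat eqSS.
  by rewrite gtn_eqF.
pose M := \sum_(j < W) \sum_(d < W) normsq (invmx V j d).
have M0 : 0 <= M by apply: sumr_ge0 => j _; apply: sumr_ge0 => d _; exact: normsq_ge0.
(* [2 ^+ W] is the cost of [normsq_sum]; [M] majorizes each squared entry of the inverse matrix. *)
exists (2 ^+ W * M); first by rewrite mulr_ge0 // exprn_ge0.
move=> p d x pW dW.
pose u : 'rV[R[i]]_W := \row_d Defs.eval (pihomog mdeg d p) x.
have uV j : (u *m V) 0 j = Defs.eval p (t j *: x).
  rewrite (eval_scale _ _ pW) mxE; apply: eq_bigr => k _.
  by rewrite !mxE mulrC rmorphXn.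
have -> : Defs.eval (pihomog mdeg d p) x = u 0 (Ordinal dW) by rewrite mxE.
rewrite -(mulmxK Vu u) mxE (le_trans (normsq_sum _)) // -mulrA.
rewrite ler_pM2l ?exprn_gt0 // mulr_sumr; apply: ler_sum => j _.
rewrite normsqM uV mulrC ler_wpM2r ?normsq_ge0 //.
rewrite /M (bigD1 j) //= (bigD1 (Ordinal dW)) //= -addrA lerDl addr_ge0 //.
  by apply: sumr_ge0 => k _; exact: normsq_ge0.
by apply: sumr_ge0 => i _; apply: sumr_ge0 => k _; exact: normsq_ge0.
Qed.

End Homogeneous.

(** * Measurability of polynomial evaluation *)

Section MeasurableEval.
Context {R : realType} {N : nat}.
Local Open Scope complex_scope.
Local Notation P := (mpoly N R[i]).

Lemma row_measurable_eval (p : P) :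
  row_measurable (fun x : 'rV[R]_N => complex.Re (Defs.eval p x)) /\
  row_measurable (fun x : 'rV[R]_N => complex.Im (Defs.eval p x)).
Proof.
(* [M] contains constants and coordinates and is closed under sums and products, hence contains
   every polynomial function. *)
pose M (f : 'rV[R]_N -> R[i]) := row_measurable (fun x => complex.Re (f x)) /\
  row_measurable (fun x => complex.Im (f x)).
have McM f g : M f -> M g -> M (fun x => f x * g x).
  move=> [f1 f2] [g1 g2]; split.
    rewrite (_ : (fun x => _) = fun x => complex.Re (f x) * complex.Re (g x) -
        complex.Im (f x) * complex.Im (g x)).
      by apply: measurable_funB; apply: measurable_funM;
        [exact: f1|exact: g1|exact: f2|exact: g2].
    by apply/funext => x /=; case: (f x) (g x) => [? ?] [].
  rewrite (_ : (fun x => _) = fun x => complex.Re (f x) * complex.Im (g x) +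
      complex.Im (f x) * complex.Re (g x)).
    by apply: measurable_funD; apply: measurable_funM;
      [exact: f1|exact: g2|exact: f2|exact: g1].
  by apply/funext => x /=; case: (f x) (g x) => [? ?] [].
have McD f g : M f -> M g -> M (fun x => f x + g x).
  move=> [f1 f2] [g1 g2]; split.
    rewrite (_ : (fun x => _) = fun x => complex.Re (f x) + complex.Re (g x)).
      by apply: measurable_funD; [exact: f1|exact: g1].
    by apply/funext => x /=; case: (f x) (g x) => [? ?] [].
  rewrite (_ : (fun x => _) = fun x => complex.Im (f x) + complex.Im (g x)).
    by apply: measurable_funD; [exact: f2|exact: g2].
  by apply/funext => x /=; case: (f x) (g x) => [? ?] [].
have Mcst (a : R[i]) : M (fun=> a) by split; exact: measurable_cst.
have MX i : M (fun x => (x 0 i)%:C).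
  by split; [exact: row_measurable_coord|exact: measurable_cst].
suff : M (Defs.eval p) by [].
rewrite (_ : Defs.eval p = fun x =>
    \sum_(m <- msupp p) mcoeff m p * \prod_i (x 0 i)%:C ^+ m i); last first.
  by apply/funext => x; rewrite /Defs.eval mevalE.
elim: (msupp p) => [|m s IH].
  by under eq_fun do rewrite big_nil; exact: Mcst.
under eq_fun do rewrite big_cons.
apply: (McD) IH; apply: (McM) => //.
elim: (index_enum _) => [|i r IH].
  by under eq_fun do rewrite big_nil; exact: Mcst.
under eq_fun do rewrite big_cons.
apply: (McM) IH; elim: (m i) => [|k IH].
  by under eq_fun do rewrite expr0; exact: Mcst.
by under eq_fun do rewrite exprS; exact: McM.
Qed.

Lemma row_measurable_normsq_eval (p : P) :
  row_measurable (fun x : 'rV[R]_N => normsq (Defs.eval p x)).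
Proof.
have [m1 m2] := row_measurable_eval p.
under eq_fun do rewrite normsqE !expr2.
by apply: measurable_funD; apply: measurable_funM;
  [exact: m1|exact: m1|exact: m2|exact: m2].
Qed.

End MeasurableEval.

(** * Box integrals against a homogeneous weight *)

Section Dilates.
Context {R : realType} {N : nat}.
Local Open Scope ereal_scope.
Local Notation P := (mpoly N R[i]).

Lemma row_integral_sum n W (g : 'I_W -> 'rV[R]_n -> R) :
  (forall j, row_measurable (g j)) -> (forall j x, 0 <= g j x)%R ->
  row_integral (fun x => \sum_j g j x)%R = \sum_j row_integral (g j).
Proof.
move=> mg g0; rewrite /row_integral.
under eq_integral => t _ do rewrite -sumEFin.
rewrite ge0_integral_sum //.
- by move=> j; apply: measurableT_comp => //; exact: mg.
- by move=> j t _; rewrite lee_fin.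
Qed.

Variables (w : 'rV[R]_N -> R) (lam : R -> R) (e : R).
Hypotheses (mw : row_measurable w) (w0 : forall x, (0 <= w x)%R).
Hypothesis (lam_gt0 : forall a, (0 < a)%R -> (0 < lam a)%R).
Hypothesis (wZ : forall a x, (0 < a)%R -> w (a *: x)%R = (lam a * w x)%R).

Definition box_integral (g : 'rV[R]_N -> R) : \bar R :=
  row_integral (fun x => \1_(box e) x * (g x * w x))%R.

Lemma box_integral_measurable g : row_measurable g ->
  row_measurable (fun x => \1_(box e) x * (g x * w x))%R.
Proof.
move=> mg.
by apply: row_measurableM; [exact: row_measurable_box|exact: row_measurableM].
Qed.

Lemma box_integral_ge0 (g : 'rV[R]_N -> R) :
  (forall x, 0 <= g x)%R -> 0 <= box_integral g.
Proof. by move=> g0; apply: integral_ge0 => t _; rewrite lee_fin !mulr_ge0. Qed.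

Lemma le_box_integral_sum (C : R) W (g : 'rV[R]_N -> R) (h : 'I_W -> 'rV[R]_N -> R) :
  (0 <= C)%R -> row_measurable g -> (forall x, 0 <= g x)%R ->
  (forall j, row_measurable (h j)) -> (forall j x, 0 <= h j x)%R ->
  (forall x, g x <= C * \sum_j h j x)%R ->
  box_integral g <= C%:E * \sum_j box_integral (h j).
Proof.
move=> C0 mg g0 mh h0 gh.
have mhj j := box_integral_measurable (mh j).
have h0j j x : (0 <= \1_(box e) x * (h j x * w x))%R by rewrite !mulr_ge0.
have hs x : (0 <= \sum_j (\1_(box e) x * (h j x * w x)))%R.
  by apply: sumr_ge0 => j _.
have mhs : row_measurable (fun x => \sum_j (\1_(box e) x * (h j x * w x)))%R.
  by apply: measurable_sum => j; exact: mhj.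
rewrite /box_integral -row_integral_sum // -row_integralZl //.
apply: le_row_integral => //.
- exact: box_integral_measurable.
- by apply: measurable_funM => //; exact: mhs.
- by move=> x; rewrite !mulr_ge0.
move=> x; rewrite -mulr_sumr -mulr_suml [leRHS]mulrCA ler_wpM2l //.
by rewrite mulrA ler_wpM2r.
Qed.

(** As [t <= 1], [x] in the box forces [t *: x] in it; homogeneity of [w] and the substitution then
    cost only the finite factor [(lam t)^-1 * t ^- N]. *)
Lemma box_integral_dilate (g : 'rV[R]_N -> R) (t : R) :
  (0 < t <= 1)%R -> row_measurable g -> (forall x, 0 <= g x)%R ->
  box_integral g < +oo -> box_integral (fun x => g (t *: x))%R < +oo.
Proof.
move=> /andP[t0 t1] mg g0 gfin.
have mgt := row_measurable_scale t mg.
have m1 := box_integral_measurable mg.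
have q0 x : (0 <= \1_(box e) x * (g x * w x))%R by rewrite !mulr_ge0.
apply: (@le_lt_trans _ _ (row_integral (fun x =>
    (lam t)^-1 * (\1_(box e) (t *: x) * (g (t *: x) * w (t *: x)))))%R).
  apply: le_row_integral.
  - exact: box_integral_measurable.
  - apply: measurable_funM => //.
    exact: (row_measurable_scale t m1).
  - by move=> x; rewrite !mulr_ge0.
  move=> x; rewrite wZ // (mulrCA (g _)) (mulrCA (\1_(box e) (t *: x)%R)).
  rewrite mulKf ?gt_eqF ?lam_gt0 //; apply: le_indic_box; first by rewrite mulr_ge0.
  move=> xe i; rewrite mxE normrM gtr0_norm // (le_trans _ (xe i)) //.
  by rewrite ler_piMl.
rewrite row_integralZl; first last.
- by move=> x.
- exact: (row_measurable_scale t m1).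
- by rewrite invr_ge0 ltW ?lam_gt0.
rewrite (row_integral_dilate t0 m1 q0) muleA -EFinM lte_mul_pinfty //.
by rewrite lee_fin mulr_ge0 ?invr_ge0 ?exprn_ge0 // ltW // lam_gt0.
Qed.

Lemma box_integral_pihomog (F : P) d :
  box_integral (fun x => normsq (Defs.eval F x)) < +oo ->
  box_integral (fun x => normsq (Defs.eval (pihomog mdeg d F) x)) < +oo.
Proof.
(* [W] must also exceed [d], which may lie beyond the degree of [F]. *)
move=> Ffin; have [W FW dW] : exists2 W, (msize F <= W)%N & (d < W)%N.
  by exists (maxn (msize F) d.+1); rewrite ?leq_maxl ?leq_maxr.
have [C C0 hC] := @normsq_pihomog_le R N W.
have mF := row_measurable_normsq_eval F.
have F0 x : (0 <= normsq (Defs.eval F x))%R by exact: normsq_ge0.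
pose h (j : 'I_W) (x : 'rV[R]_N) := normsq (Defs.eval F (j.+1%:R^-1 *: x)).
have mh j : row_measurable (h j) by exact: (row_measurable_scale _ mF).
have h0 j x : (0 <= h j x)%R by exact: normsq_ge0.
have h_fin j : box_integral (h j) < +oo.
  apply: (box_integral_dilate (g := fun x => normsq (Defs.eval F x))) => //.
  by rewrite invr_gt0 ltr0n /= invf_le1 ?ltr0n // ler1n.
apply: (@le_lt_trans _ _ (C%:E * \sum_j box_integral (h j))).
  apply: le_box_integral_sum => //.
  - exact: row_measurable_normsq_eval.
  - by move=> x; exact: normsq_ge0.
  - by move=> x; exact: hC.
apply: lte_mul_pinfty; rewrite ?lee_fin //.
by elim/big_ind: _; [exact: ltry|exact: lte_add_pinfty|move=> j _; exact: h_fin].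
Qed.

(** All components of [p] have degree below [k] and are components of [F], hence integrable.
    Dilation by [r] multiplies the one of degree [d] by [r ^+ d], whose square is at most
    [r ^+ (2 * k)] for [r >= 1]. *)
Lemma box_integral_poly_dilate (F p : P) k :
  (msize p <= k)%N ->
  (forall d, (d < k)%N -> pihomog mdeg d p = pihomog mdeg d F) ->
  box_integral (fun x => normsq (Defs.eval F x)) < +oo ->
  exists2 K : R, (0 <= K)%R & forall r : R, (1 <= r)%R ->
    box_integral (fun x => normsq (Defs.eval p (r *: x))) <= (K * r ^+ (2 * k))%:E.
Proof.
move=> pk pF Ffin.
pose h (d : 'I_k) (x : 'rV[R]_N) := normsq (Defs.eval (pihomog mdeg d F) x).
have mh d : row_measurable (h d) by exact: row_measurable_normsq_eval.
have h0 d x : (0 <= h d x)%R by exact: normsq_ge0.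
have hfin d : box_integral (h d) < +oo by exact: box_integral_pihomog.
have S0 : 0 <= \sum_d box_integral (h d).
  by apply: sume_ge0 => d _; exact: box_integral_ge0.
have Sfin : \sum_d box_integral (h d) \is a fin_num.
  rewrite ge0_fin_numE //.
  by elim/big_ind: _; [exact: ltry|exact: lte_add_pinfty|move=> j _; exact: hfin].
exists (2 ^+ k * fine (\sum_d box_integral (h d)))%R.
  by rewrite mulr_ge0 ?exprn_ge0 // fine_ge0.
move=> r r1; have r0 : (0 <= r)%R by rewrite (le_trans ler01).
rewrite mulrAC EFinM fineK //; apply: le_box_integral_sum => //.
- by rewrite mulr_ge0 // exprn_ge0.
- exact: (row_measurable_scale r (row_measurable_normsq_eval p)).
- by move=> x; exact: normsq_ge0.
move=> x; rewrite (eval_scale _ _ pk) (le_trans (normsq_sum _)) // -mulrA.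
rewrite ler_pM2l ?exprn_gt0 // mulr_sumr; apply: ler_sum => d _.
rewrite pF // normsqM normsq_real ler_wpM2r //; first exact: normsq_ge0.
by rewrite -exprM ler_weXn2l // mulnC leq_mul2l /= ltnW.
Qed.

End Dilates.

(** * The weight and its localization at [b] *)

Section Weight.
Context {R : realType} {N : nat}.
Implicit Types (Phi Pos : {fset 'rV[R]_N}) (alpha b u v x z : 'rV[R]_N).

Definition weight Pos (c : R) (Q : pred 'rV[R]_N) x : R :=
  \prod_(alpha <- Pos | Q alpha) `|dot alpha x| `^ (- (2 * c)).

(** A power of [a] with exponent [-2c] times the number of selected roots, kept as a product so that
    it matches [weight] factor by factor. *)
Definition weight_factor Pos (c : R) (Q : pred 'rV[R]_N) (a : R) : R :=
  \prod_(alpha <- Pos | Q alpha) a `^ (- (2 * c)).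

Lemma dotDr u v x : dot u (v + x) = dot u v + dot u x :> R.
Proof. by rewrite -big_split; apply: eq_bigr => i _; rewrite mxE mulrDr. Qed.

Lemma dotZr (a : R) u v : dot u (a *: v) = a * dot u v.
Proof. by rewrite mulr_sumr; apply: eq_bigr => i _; rewrite mxE mulrCA. Qed.

Lemma weight_ge0 Pos c Q x : 0 <= weight Pos c Q x.
Proof. by apply: prodr_ge0 => alpha _; exact: powR_ge0. Qed.

Lemma row_measurable_weight Pos c Q : row_measurable (weight Pos c Q).
Proof.
rewrite /row_measurable /weight; under eq_fun do rewrite big_mkcond /=.
apply: measurable_prod => alpha _.
case: (Q alpha); last exact: measurable_cst.
have m1 : row_measurable (fun x => dot alpha x).
  exact: (@row_measurable_dot _ _ (fun=> alpha) id
    (fun i => measurable_cst _) (@row_measurable_coord _ N)).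
apply: (measurableT_comp (measurable_powR _)).
exact: (measurableT_comp (@normr_measurable R setT) m1).
Qed.

Lemma weight_factor_gt0 Pos c Q a : 0 < a -> 0 < weight_factor Pos c Q a.
Proof. by move=> a0; apply: prodr_gt0 => alpha _; exact: powR_gt0. Qed.

Lemma weightZ Pos c Q a x : 0 < a ->
  weight Pos c Q (a *: x) = weight_factor Pos c Q a * weight Pos c Q x.
Proof.
move=> a0; rewrite -big_split; apply: eq_bigr => alpha _ /=.
by rewrite dotZr normrM gtr0_norm // powRM // ltW.
Qed.

Lemma weight_factorX Pos c Q (a : R) j : 0 < a ->
  weight_factor Pos c Q (a ^+ j) = weight_factor Pos c Q a ^+ j.
Proof.
move=> a0; rewrite -prodrXl; apply: eq_bigr => alpha _.
elim: j => [|j IH]; first by rewrite !expr0 powR1.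
by rewrite !exprS powRM ?exprn_ge0 ?IH // ltW.
Qed.

(** The sign of the exponent, like that of [c], is arbitrary: the power is increasing or decreasing
    in its base, and the minimum of the endpoint values covers both cases. *)
Lemma powR_min_le (u v t s : R) : 0 < u -> u <= t <= v ->
  Num.min (u `^ s) (v `^ s) <= t `^ s.
Proof.
move=> u0 /andP[ut tv]; have t0 := lt_le_trans u0 ut; have v0 := lt_le_trans t0 tv.
have [s0|s0] := leP 0 s.
  by rewrite ge_min; apply/orP; left; rewrite ge0_ler_powR // ?nnegrE // ltW.
rewrite ge_min; apply/orP; right; rewrite -[s]opprK !(powRN _ (- s)).
rewrite lef_pV2 ?posrE ?powR_gt0 //.
by rewrite ge0_ler_powR // ?nnegrE ?oppr_ge0 // ltW.
Qed.

(** The box is centred at 0 because [z] stands for the displacement from [b]. *)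
Definition locally_bounded_below (h : 'rV[R]_N -> R) : Prop :=
  exists2 e : R, 0 < e & exists2 m : R, 0 < m & forall z, box e z -> m <= h z.

Lemma locally_bounded_belowM g h :
  locally_bounded_below g -> locally_bounded_below h ->
  locally_bounded_below (fun z => g z * h z).
Proof.
move=> [e1 e10 [m1 m10 h1]] [e2 e20 [m2 m20 h2]].
exists (Num.min e1 e2); first by rewrite lt_min e10.
exists (m1 * m2); first exact: mulr_gt0.
move=> z zb; apply: ler_pM; [exact: ltW|exact: ltW|apply: h1|apply: h2].
  by apply: le_box zb; rewrite ge_min lexx.
by apply: le_box zb; rewrite ge_min lexx orbT.
Qed.

Lemma locally_bounded_below_root alpha b (s : R) : dot alpha b != 0 ->
  locally_bounded_below (fun z => `|dot alpha (z + b)| `^ s).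
Proof.
move=> ab; pose u : R := `|dot alpha b|; have u0 : 0 < u by rewrite normr_gt0.
pose A := 1 + \sum_i `|alpha 0 i|.
have S0 : 0 <= \sum_i `|alpha 0 i| by apply: sumr_ge0.
have A0 : 0 < A by rewrite ltr_pwDl.
(* On this box [|dot alpha z| <= u / 2], which keeps [|dot alpha (z + b)|] between [u / 2] and
   [u * 2]. *)
exists (u / 2 / A); first by rewrite !divr_gt0.
exists (Num.min ((u / 2) `^ s) ((u * 2) `^ s)).
  by rewrite lt_min !powR_gt0 // ?divr_gt0 // mulr_gt0.
move=> z zb.
have az : `|dot alpha z| <= u / 2.
  rewrite (le_trans (ler_norm_sum _ _ _)) //.
  rewrite (@le_trans _ _ (\sum_i `|alpha 0 i| * (u / 2 / A))) //.
    by apply: ler_sum => i _; rewrite normrM ler_wpM2l.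
  rewrite -mulr_suml mulrCA ler_piMr ?divr_ge0 ?ltW //.
  by rewrite ltr_pdivrMr // mul1r /A ltrDr.
apply: powR_min_le; first by rewrite divr_gt0.
rewrite dotDr; apply/andP; split.
  have := lerB_normD (dot alpha b) (dot alpha z); rewrite -/u => h.
  by rewrite (addrC (dot alpha z)); lra.
by rewrite (le_trans (ler_normD _ _)) // -/u; lra.
Qed.

Lemma locally_bounded_below_gaussian b :
  locally_bounded_below (fun z => expR (- (1 / 2) * dot (z + b) (z + b))).
Proof.
exists 1 => //; exists (expR (- (1 / 2) * \sum_i (1 + `|b 0 i|) ^+ 2)).
  exact: expR_gt0.
move=> z zb; rewrite ler_expR !mulNr lerN2 ler_pM2l ?divr_gt0 //.
apply: ler_sum => i _; rewrite -expr2 -(real_normK (num_real (_ i))).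
rewrite ler_pXn2r ?nnegrE ?addr_ge0 // mxE (le_trans (ler_normD _ _)) // lerD2r.
exact: zb.
Qed.

Lemma locally_bounded_below_weight Pos c (Q : pred 'rV[R]_N) b :
  (forall alpha, alpha \in Pos -> Q alpha -> dot alpha b != 0) ->
  locally_bounded_below (fun z => weight Pos c Q (z + b)).
Proof.
move=> h; rewrite /weight.
elim: (enum_fset Pos) (fun a => h a : a \in enum_fset Pos -> _) => [|a s IH] hs.
  by exists 1 => //; exists 1 => // z _; rewrite big_nil.
have IHs := IH (fun a' ha' => hs a' (mem_behead (s := a :: s) ha')).
have [Qa|nQa] := boolP (Q a); last first.
  case: IHs => e e0 [m m0 hm]; exists e => //; exists m => // z /hm.
  by rewrite big_cons (negPf nQa).
have := locally_bounded_belowM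
  (locally_bounded_below_root (- (2 * c)) (hs a (mem_head _ _) Qa)) IHs.
case=> e e0 [m m0 hm]; exists e => //; exists m => // z /hm.
by rewrite big_cons Qa.
Qed.

End Weight.

(** * Expansion at [b], parabolic roots and the chart of [M] *)

Section Restriction.
Context {R : realType} {N : nat}.
Local Notation P := (mpoly N R[i]).
Implicit Types (Phi Pos : {fset 'rV[R]_N}) (alpha b x z : 'rV[R]_N) (p : P).

(** The polynomial whose coefficients form [taylor b p]. *)
Definition translate b p : P :=
  comp_mpoly [tuple coordinate i + mpolyC N (real_complex R (b 0 i)) | i < N] p.

Lemma eval_translate b p x : Defs.eval (translate b p) x = Defs.eval p (x + b).
Proof.
rewrite /Defs.eval comp_mpoly_meval; congr (meval _ p); apply/funext => i.
rewrite tnth_mktuple mevalD mevalXU mevalC mxE.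
by rewrite rmorphD.
Qed.

Lemma eq_pihomog p q d :
  (forall m : multinom N, mdeg m = d -> mcoeff m p = mcoeff m q) ->
  pihomog mdeg d p = pihomog mdeg d q.
Proof.
move=> pq; have [W pW qW] : exists2 W, (msize p <= W)%N & (msize q <= W)%N.
  by exists (maxn (msize p) (msize q)); [exact: leq_maxl|exact: leq_maxr].
rewrite (pihomogwE _ _ pW) (pihomogwE _ _ qW).
by apply: eq_bigr => m /eqP md; rewrite pq.
Qed.

(** The point [b] itself lies in its stratum, and a root vanishing at [b] vanishes on the stratum by
    definition. *)
Lemma parabolic_rootE Phi b alpha : alpha \in Phi ->
  parabolic_root Phi b alpha = (dot alpha b == 0).
Proof.
move=> aPhi; apply/asboolP/eqP => [h|ab l Ll]; last exact: Ll.
by apply: h => beta _.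
Qed.

Lemma row_measurable_gaussian_density Pos c Q b p :
  row_measurable (gaussian_density Pos c Q b p).
Proof.
apply: row_measurableM; last exact: row_measurable_weight.
apply: row_measurableM; first exact: row_measurable_normsq_eval.
exact: (row_measurable_shift (- b) (@row_measurable_gaussian R N)).
Qed.

Lemma gaussian_density_ge0 Pos c Q b p x : 0 <= gaussian_density Pos c Q b p x.
Proof.
by rewrite mulr_ge0 ?weight_ge0 // mulr_ge0 ?expR_ge0 // sqr_ge0.
Qed.

Lemma weight_parabolicD Phi Pos c b z :
  (forall alpha, alpha \in Pos -> alpha \in Phi) ->
  weight Pos c (parabolic_root Phi b) (z + b) = weight Pos c (parabolic_root Phi b) z.
Proof.
move=> sPos; rewrite /weight big_seq_cond [RHS]big_seq_cond.
apply: eq_bigr => alpha /andP[/sPos aPhi].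
by rewrite parabolic_rootE // => /eqP ab; rewrite dotDr ab addr0.
Qed.

(** After the shift by [b], the Gaussian and the non-parabolic roots contribute a factor at least
    [m > 0] on a small box. What remains is the weight of the parabolic roots, unchanged by the
    shift since they vanish at [b]. *)
Lemma box_integral_translate_lt_pinfty Phi Pos c b p :
  (forall alpha, alpha \in Pos -> alpha \in Phi) ->
  (row_integral (gaussian_density Pos c predT 0 p) < +oo)%E ->
  exists2 e : R, 0 < e &
    (box_integral (weight Pos c (parabolic_root Phi b)) e
       (fun z => normsq (Defs.eval (translate b p) z)) < +oo)%E.
Proof.
move=> sPos pfin; set Q := parabolic_root Phi b.
have [e e0 [m m0 hm]] : locally_bounded_below (fun z =>
    expR (- (1 / 2) * dot (z + b) (z + b)) * weight Pos c (predC Q) (z + b)).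
  apply: locally_bounded_belowM; first exact: locally_bounded_below_gaussian.
  apply: locally_bounded_below_weight => alpha /sPos aPhi.
  by rewrite /= /Q parabolic_rootE.
exists e => //.
pose D x := gaussian_density Pos c predT 0 p x.
have mD : row_measurable D by exact: row_measurable_gaussian_density.
have D0 x : 0 <= D x by exact: gaussian_density_ge0.
have wT x : weight Pos c predT x = weight Pos c Q x * weight Pos c (predC Q) x.
  by rewrite /weight (bigID Q).
apply: (@le_lt_trans _ _ (row_integral (fun z => m^-1 * D (z + b)))).
  apply: le_row_integral.
  - apply: box_integral_measurable; first exact: row_measurable_weight.
    exact: row_measurable_normsq_eval.
  - by apply: measurable_funM => //; exact: (row_measurable_shift b mD).
  - move=> z; apply: mulr_ge0 => //.
    by apply: mulr_ge0; [exact: normsq_ge0|exact: weight_ge0].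
  move=> z; rewrite eval_translate /D /gaussian_density subr0 -/(weight _ _ _ _).
  rewrite wT weight_parabolicD //.
  rewrite mulrC -ler_pdivrMl ?invr_gt0 // invrK.
  set E := expR _; set W := weight _ _ _ _; set W' := weight _ _ _ _.
  set n := normsq _; change (Normc.normc _ ^+ 2) with n.
  have n0 : 0 <= n by exact: normsq_ge0.
  have E0 : 0 <= E by exact: expR_ge0.
  have W0 : 0 <= W by exact: weight_ge0.
  have W'0 : 0 <= W' by exact: weight_ge0.
  have -> : n * E * (W * W') = E * W' * (n * W) by ring.
  rewrite indicE; have [/set_mem /hm hz|_] := boolP (z \in _).
    by rewrite mulr1 ler_wpM2r // mulr_ge0.
  by rewrite !mulr0; apply: mulr_ge0; apply: mulr_ge0.
rewrite row_integralZl ?invr_ge0 ?(ltW m0) //; last exact: (row_measurable_shift b mD).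
rewrite row_integral_shift //; apply: lte_mul_pinfty => //.
by rewrite lee_fin invr_ge0 ltW.
Qed.

(** A root vanishing at [b] is orthogonal to the stratum, so [b + alpha] lies in [M] and [alpha] in
    the row space of [B], on which [B^T *m B] acts as the identity. *)
Lemma chart_proj Phi b n (B : 'M[R]_(n, N)) alpha z :
  orthonormal_chart Phi b B -> alpha \in Phi -> dot alpha b = 0 ->
  dot alpha (z *m B^T *m B) = dot alpha z.
Proof.
move=> [BB MB] aPhi ab.
have : normal_plane Phi b (b + alpha).
  by move=> l Ll; rewrite addrC addKr; exact: Ll.
rewrite MB => -[y _ /addrI <-].
by rewrite !dotE !trmx_mul trmxK -!mulmxA (mulmxA B B^T) BB mul1mx.
Qed.

End Restriction.

Theorem proposition6p12 (R : realType) (N : nat)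
  (Phi Pos : {fset 'rV[R]_N}) (c : R)
  (Phi_roots : root_system Phi) (Phi_rank : full_rank Phi)
  (Phi_irr : irreducible_roots Phi) (Phi_pos : positive_system Phi Pos)
  (S : set (mpoly N R[i])) (S_min : minimal_submodule Phi Pos c S)
  (b : 'rV[R]_N) :
  gaussian_converges Pos c S ->
  gaussian_converges_at Phi Pos c b (Res Phi b S).
Proof.
move=> Sconv n B chartB p [pS pL].
have [BB _] := chartB.
have sPos alpha : alpha \in Pos -> alpha \in Phi.
  by have [t [_ ->]] := Phi_pos => /andP[].
set Q := parabolic_root Phi b; pose w := weight Pos c Q.
pose lam := weight_factor Pos c Q.
pose p' := translate b p; pose k := msize p'.
(* All degrees occurring in [p'] are below [k], so [f] expanded at [b] has every homogeneous
   component of [p'] among its own. *)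
have [f Sf pf] := pS k.
have [e e0 ffin] := box_integral_translate_lt_pinfty b sPos (Sconv f Sf).
have mw : row_measurable w by exact: row_measurable_weight.
have w0 x : 0 <= w x by exact: weight_ge0.
have wZ a x : 0 < a -> w (a *: x) = lam a * w x by exact: weightZ.
have lam0 a : 0 < a -> 0 < lam a by exact: weight_factor_gt0.
have [K K0 hK] : exists2 K : R, 0 <= K & forall r : R, 1 <= r ->
    (box_integral w e (fun x => normsq (Defs.eval p' (r *: x))) <=
     (K * r ^+ (2 * k))%:E)%E.
  apply: (box_integral_poly_dilate mw w0 lam0 wZ (leqnn _) _ ffin) => d dk.
  by apply: eq_pihomog => m md; apply: pf; rewrite md.
have proj_w z : w (z *m B^T *m B) = w z.
  rewrite /w /weight big_seq_cond [RHS]big_seq_cond.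
  apply: eq_bigr => alpha /andP[/sPos aPhi].
  by rewrite /Q parabolic_rootE // => /eqP ab; rewrite (chart_proj _ chartB).
(* The difference between [z] and its projection is orthogonal to the roots vanishing at [b], hence
   lies in the stratum, along which [p] is constant. *)
have proj_p r z : Defs.eval p' (r *: (z *m B^T *m B)) = Defs.eval p' (r *: z).
  rewrite !eval_translate -[in RHS](subrK (z *m B^T *m B) z) scalerDr.
  rewrite [(r *: (z - _) + _)%R]addrC addrAC; apply/esym/pL => alpha aPhi ab.
  by rewrite dotZr dotDr -scaleN1r dotZr (chart_proj _ chartB) // mulN1r subrr mulr0.
(* The integrand on [M] in chart coordinates, with only the polynomial dilated; by [proj_w] and
   [proj_p], composing it with [z |-> z *m B^T] gives back the integrand on the whole space. *)
pose G r y := normsq (Defs.eval p' (r *: (y *m B))) * w (y *m B).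
have mG r : row_measurable (G r).
  apply: (row_measurable_lin B (g := fun x => normsq (Defs.eval p' (r *: x)) * w x)).
  apply: row_measurableM mw.
  exact: (row_measurable_scale r (row_measurable_normsq_eval p')).
have G0 r y : 0 <= G r y by apply: mulr_ge0 => //; exact: normsq_ge0.
have [d d0 [K' K'0 hK']] := integral_box_fiber BB e0.
have GK r : 1 <= r ->
    (row_integral (fun y => \1_(box d) y * G r y)%R <= (K' * (K * r ^+ (2 * k)))%:E)%E.
  move=> r1; apply: (le_trans (hK' _ (mG r) (G0 r))).
  rewrite EFinM lee_wpmul2l ?lee_fin //; apply: le_trans (hK r r1).
  rewrite le_eqVlt; apply/orP; left; apply/eqP.
  by congr row_integral; apply/funext => z; rewrite /G proj_w proj_p.
(* [lam (2 ^+ j)] is [lam 2 ^+ j]; bounding [lam 2] by an integer power of 2 replaces the real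
   exponent of the weight by a natural number. *)
pose E0 := Num.Def.archi_bound (lam 2).
have lamE j : lam (2 ^+ j) <= (2 ^+ E0) ^+ j.
  rewrite /lam weight_factorX // lerXn2r ?nnegrE ?exprn_ge0 ?ltW ?lam0 //.
  exact: upper_nthrootP.
have : (row_integral (fun y => G 1 y * expR (- (1 / 2) * dot y y))%R < +oo)%E.
  (* The growth exponent adds the Jacobian [n], the weight [E0] and the polynomial [2 * k]. *)
  apply: (@gaussian_integral_lt_pinfty _ _ d (K' * K) (n + E0 + 2 * k) (G 1)) => // j.
  pose r : R := 2 ^+ j.
  have r1 : 1 <= r by rewrite exprn_ege1 // ler1n.
  have r0 : 0 < r by rewrite exprn_gt0.
  have GH y : G 1 (r *: y) = lam r * G r y.
    by rewrite /G scale1r -scalemxAl wZ // mulrCA.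
  rewrite (row_integral_box_dilate d r0 (ltW (lam0 r r0)) (mG 1) (mG r) (G0 1)
    (G0 r) GH).
  apply: (@le_trans _ _ ((r ^+ n * lam r)%:E * (K' * (K * r ^+ (2 * k)))%:E)%E).
    by rewrite lee_wpmul2l ?lee_fin ?GK // mulr_ge0 ?exprn_ge0 ?ltW ?lam0.
  have rX (m : nat) : (2 ^+ m) ^+ j = r ^+ m by rewrite -!exprM mulnC.
  have lamr : lam r <= r ^+ E0 by rewrite -rX; exact: lamE.
  rewrite -EFinM lee_fin rX; clearbody r E0; move: (2 * k)%N => k2.
  pose M := r ^+ n * (K' * (K * r ^+ k2)).
  have M0 : 0 <= M by rewrite !mulr_ge0 ?exprn_ge0 // ltW.
  have -> : r ^+ n * lam r * (K' * (K * r ^+ k2)) = lam r * M by rewrite /M; ring.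
  have -> : K' * K * r ^+ (n + E0 + k2) = r ^+ E0 * M by rewrite /M !exprD; ring.
  exact: ler_wpM2r.
(* At [b + y *m B] the density is that of [G 1 y] times the Gaussian in [y]: the weight ignores the
   shift by [b], and the chart is an isometry. *)
congr (_ < _)%E; apply: eq_integral => t _; set y := row_of_tuple t; congr EFin.
rewrite /gaussian_density -/(weight _ _ _ _) addrC addrK.
rewrite weight_parabolicD // -eval_translate.
rewrite (_ : dot (y *m B) (y *m B) = dot y y).
  by rewrite /G scale1r mulrAC.
by rewrite !dotE trmx_mul mulmxA -(mulmxA y) BB mulmx1.
Qed.
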